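(* Let $-d<0$ be a fundamental discriminant and let $\chi$ be the real primitive character of conductor $d$ attached to $\mathbb{Q}(\sqrt{-d})$, with $L(s,\chi)=\sum_{n\ge1}\chi(n)n^{-s}$. Suppose $L(1,\chi)\geq (\log d)^{-18}$. If $-d$ has one class per genus, then $d\leq d_{66}\approx 1.9\cdot 10^{130}$.
   Context: For $g\ge 1$, $d_g$ denotes the product of the first $g$ primes. For a fundamental discriminant $-d<0$, let $\mathcal{C}(-d)$ be the ideal class group of $\mathbb{Q}(\sqrt{-d})$ and $h(-d)$ its order. Let $g$ be the number of prime (primary) discriminants dividing $-d$, equivalently the number of distinct primes dividing $d$; the reduced forms of discriminant $-d$ fall into $2^{g-1}$ genera. The discriminant $-d$ is said to have one class per genus if each genus contains exactly one class, i.e. $\mathcal{C}(-d)\cong(\mathbb{Z}/2\mathbb{Z})^{g-1}$, equivalently $h(-d)=2^{g-1}$. *)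

(* Defs.v *)
From mathcomp Require Import all_boot.
From mathcomp Require Import all_algebra.

Set Implicit Arguments.
Unset Strict Implicit.
Unset Printing Implicit Defensive.

Lemma ex_prime_gt (m : nat) : exists p, (m < p) && prime p.
Proof. by case: (prime_above m) => p H1 H2; exists p; rewrite H1 H2. Qed.

Definition next_prime (m : nat) : nat := ex_minn (ex_prime_gt m).

Fixpoint nth_prime (i : nat) : nat :=
  match i with
  | 0 => 2
  | i'.+1 => next_prime (nth_prime i')
  end.

Definition dprim (g : nat) : nat := \prod_(i < g) nth_prime i.

Definition squarefree (m : nat) : bool :=
  [forall p : 'I_m.+1, prime p ==> ~~ (p * p %| m)].

(* -d is a fundamental discriminant (d > 0): either -d = 1 mod 4 and
   squarefree, or -d = 4 m' with m' = 2,3 mod 4 squarefree; in terms of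
   d: d = 3 mod 4 squarefree, or d = 4 m with m = 1,2 mod 4 squarefree. *)
Definition neg_fund_disc (d : nat) : Prop :=
  0 < d /\
  ((d %% 4 = 3 /\ squarefree d) \/
   (d %% 4 = 0 /\ ((d %/ 4) %% 4 = 1 \/ (d %/ 4) %% 4 = 2) /\ squarefree (d %/ 4))).

(* number of prime discriminants dividing -d = number of distinct primes dividing d *)
Definition genus_g (d : nat) : nat := size (primes d).

Definition reduced_form (d : nat) (a : nat) (b : int) (c : nat) : bool :=
  [&& (b * b - Posz 4 * Posz a * Posz c == - Posz d)%R,
      0 < a, (`|b| <= a)%N, a <= c,
      ((`|b|%N == a) || (a == c)) ==> (0 <= b)%R &
      gcdn (gcdn a `|b|) c == 1].

(* h(-d) = number of reduced forms of discriminant -d; all such forms have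
   a, c <= d and |b| <= d, so the search box below is exhaustive. *)
Definition class_number (d : nat) : nat :=
  #|[set t : 'I_d.+1 * 'I_(2 * d).+1 * 'I_d.+1 |
      reduced_form d t.1.1 (Posz t.1.2 - Posz d)%R t.2]|.

From Stdlib Require Import Reals.

Definition kron_prime (d p : nat) : R :=
  if p == 2 then
    (if odd d then (if d %% 8 == 7 then 1%R else (-1)%R) else 0%R)
  else if p %| d then 0%R
  else if [exists x : 'I_p, (x * x + d) %% p == 0] then 1%R
  else (-1)%R.

Definition kron (d n : nat) : R :=
  if n == 0 then 0%R
  else List.fold_right Rmult 1%R [seq (kron_prime d p ^ logn p n)%R | p <- primes n].

Definition L1_partial (d N : nat) : R :=
  sum_f_R0 (fun k => (kron d k.+1 / INR k.+1)%R) N.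

(* Main.v *)
(** Let [r(n)] be the sum of [chi(m)] over [m | n].  Multiplicativity and Hensel
    lifting show that [r(n)] counts the pairs [(k, t)] with [k^2 | n] and [t] a
    root of the principal polynomial modulo [n / k^2].  Each such pair gives a
    binary quadratic form of discriminant [-d], and reducing it yields a vector on
    which a reduced form takes the value [n]; the vector and the reduced form
    determine the pair.  Counting lattice points in the half ellipses
    [F(x, y) <= N] bounds the sum of [r(n)] over [n <= N] by
    [h(-d) (4 N / sqrt d + O(sqrt N))], whereas Abel summation shows that, on
    average over [N], this sum is [L(1, chi) N + o(N)].
    Hence [L(1, chi) sqrt d <= 4 h(-d)].

    If [h(-d) = 2^(g-1)] and [L(1, chi) >= (log d)^(-18)], this gives
    [sqrt d <= 2^(g+1) (log d)^18], while [d >= d_g] because [d] has [g] prime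
    factors.  As [d_66 > 2^432] and all further primes exceed [16], this is
    impossible for [d > d_66]. *)

Require Import Defs.
From mathcomp Require Import all_boot all_order all_algebra.
From mathcomp Require Import zify.
From Stdlib Require Import PeanoNat ZArith Reals Lra.

Set Implicit Arguments.
Unset Strict Implicit.
Unset Printing Implicit Defensive.

(** * Primorials and the size of [dprim 66] *)

Section Primorial.

Lemma next_primeP m : (m < next_prime m) && prime (next_prime m).
Proof. by rewrite /next_prime; case: ex_minnP. Qed.

Lemma next_prime_le m p : m < p -> prime p -> next_prime m <= p.
Proof. by move=> mp pp; rewrite /next_prime; case: ex_minnP => q _; apply; rewrite mp. Qed.

Lemma nth_prime_ge i : i.+2 <= nth_prime i.
Proof.
elim: i => //= i IH; apply: leq_ltn_trans IH _.
by case/andP: (next_primeP (nth_prime i)).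
Qed.

(** By minimality of [next_prime], the entry at index [i] of an increasing list of primes is at
    least [nth_prime i], so the products compare factor by factor. *)
Lemma dprim_le_prod (s : seq nat) : sorted ltn s -> all prime s ->
  dprim (size s) <= \prod_(p <- s) p.
Proof.
move=> ss ps; rewrite (big_nth 0) big_mkord /dprim; apply: leq_prod => -[i /= si] _.
have pn j : j < size s -> prime (nth 0 s j) by move=> js; apply: (allP ps); rewrite mem_nth.
elim: i si => [|i IH] si; first by rewrite prime_gt1 // pn.
apply: next_prime_le; last exact: pn.
by apply: leq_ltn_trans (IH (ltnW si)) _; apply: (sortedP 0 ss).
Qed.

Lemma prod_primes_le (n : nat) : 0 < n -> \prod_(p <- primes n) p <= n.
Proof.
move=> n0; rewrite [leqRHS](prod_prime_decomp n0) prime_decompE big_map /=.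
rewrite !big_seq; apply: leq_prod => p pn /=.
by rewrite -{1}(expn1 p) leq_pexp2l ?logn_gt0 // prime_gt0 //; move: pn; rewrite mem_primes; case/and3P.
Qed.

Lemma dprim_genus_le (d : nat) : 0 < d -> dprim (genus_g d) <= d.
Proof.
move=> d0; apply: leq_trans (prod_primes_le d0); apply: dprim_le_prod.
  exact: sorted_primes.
by apply/allP => p; rewrite mem_primes; case/andP.
Qed.

Definition primes317 : seq nat :=
  [:: 2; 3; 5; 7; 11; 13; 17; 19; 23; 29; 31; 37; 41; 43; 47; 53; 59; 61; 67; 71;
   73; 79; 83; 89; 97; 101; 103; 107; 109; 113; 127; 131; 137; 139; 149; 151;
   157; 163; 167; 173; 179; 181; 191; 193; 197; 199; 211; 223; 227; 229; 233;
   239; 241; 251; 257; 263; 269; 271; 277; 281; 283; 293; 307; 311; 313; 317].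

(** A finite check that the table skips no prime; it yields lower bounds for [nth_prime] without
    evaluating [next_prime]. *)
Lemma primes317_gaps : all (fun i => all (fun x => ~~ prime x)
   (iota (nth 0 primes317 i).+1 (nth 0 primes317 i.+1 - (nth 0 primes317 i).+1))) (iota 0 65).
Proof. by vm_compute. Qed.

Lemma nth_prime_ge_primes317 i : i < 66 -> nth 0 primes317 i <= nth_prime i.
Proof.
move: primes317_gaps (erefl : nth 0 primes317 0 = 2); move: primes317 => s gaps s0.
elim: i => [|i IH] hi; first by rewrite s0.
have /andP[h1 h2] := next_primeP (nth_prime i).
rewrite leqNgt; apply/negP => h3.
have hi' : i \in iota 0 65 by rewrite mem_iota.
have h4 := leq_ltn_trans (IH (ltnW hi)) h1.
suff hm : next_prime (nth_prime i) \in
    iota (nth 0 s i).+1 (nth 0 s i.+1 - (nth 0 s i).+1).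
  by have := allP (allP gaps _ hi') _ hm; rewrite h2.
by rewrite mem_iota h4 subnKC // (leq_trans h4) // ltnW.
Qed.

Lemma dprim66_ge : (IZR (2 ^ 432) <= INR (dprim 66))%R.
Proof.
have prodE (s : seq nat) : foldr muln 1 s = \prod_(i < size s) nth 0 s i.
  rewrite -(big_mkord xpredT (nth 0 s)) -(big_nth 0 xpredT (fun x => x)).
  by elim: s => [|a s IH]; rewrite ?big_nil // big_cons -IH.
have h : foldr muln 1 primes317 <= dprim 66.
  by rewrite prodE; apply: leq_prod => i _; apply: nth_prime_ge_primes317; apply: ltn_ord.
apply: (Rle_trans _ (INR (foldr muln 1 primes317))); last by apply: le_INR; apply/leP.
(* In binary integers the product can be evaluated, which is out of reach in unary [nat]. *)
have -> (s : seq nat) : INR (foldr muln 1 s) = IZR (foldr Z.mul 1%Z (map Z.of_nat s)).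
  elim: s => //= a s IH; rewrite -multE mult_INR IH INR_IZR_INZ -mult_IZR //.
by apply: IZR_le; vm_compute.
Qed.

(** Since [16 ^ k = (2 ^ k) ^ 4], base 16 lets the fourth root of the excess over [2 ^ 432] absorb
    the factor [2 ^ k] of the class number. *)
Lemma dprim_ge (g : nat) : 66 <= g -> (IZR (2 ^ 432) * 16 ^ (g - 66) <= INR (dprim g))%R.
Proof.
move=> g66; rewrite -[in INR _](subnKC g66); move: (g - 66) => k {g g66}.
elim: k => [|k IH]; first by rewrite addn0 /= Rmult_1_r; exact: dprim66_ge.
rewrite addnS /dprim big_ord_recr /= -/(dprim (66 + k)) -multE mult_INR.
have h : (16 <= INR (nth_prime (66 + k)))%R.
  rewrite (_ : 16%R = INR 16); last by rewrite INR_IZR_INZ.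
  apply: le_INR; apply/leP; apply: leq_trans (nth_prime_ge _); lia.
rewrite -/(dprim (66 + k)) in IH *.
have h' : (0 < 16 ^ k)%R by apply: pow_lt; lra.
rewrite (Rmult_comm 16) -Rmult_assoc; by apply: Rmult_le_compat => //; lra.
Qed.
End Primorial.

(** * Square root against powers of the logarithm *)

Section RealBounds.
Local Open Scope R_scope.

Lemma ln_le_compat (x y : R) : 0 < x -> x <= y -> ln x <= ln y.
Proof. by move=> x0 [h|->]; [apply/Rlt_le/ln_increasing | apply: Rle_refl]. Qed.

Lemma exp_le_compat (x y : R) : x <= y -> exp x <= exp y.
Proof. by move=> [h|->]; [apply/Rlt_le/exp_increasing | apply: Rle_refl]. Qed.

Lemma exp_double_ge (x y : R) : 0 <= y -> y <= exp x -> y * y <= exp (2 * x).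
Proof.
move=> y0 h; rewrite (_ : 2 * x = x + x); last by ring.
by rewrite exp_plus; apply: Rmult_le_compat.
Qed.

(** As [300 / 432 = 25 / 36], the claim amounts to [2 <= exp (25 / 36)]. *)
Lemma ln2_le : 432 * ln 2 <= 300.
Proof.
suff h : 2 <= exp (25 / 36).
  have : ln 2 <= 25 / 36.
    by rewrite -(ln_exp (25 / 36)); apply: ln_le_compat; lra.
  lra.
have dbl n x y z : 0 <= y -> y <= exp (x / n) -> n <> 0 -> z <= y * y -> z <= exp (x / (n / 2)).
  move=> y0 h n0 hz; apply: (Rle_trans _ _ _ hz).
  rewrite (_ : x / (n / 2) = 2 * (x / n)); last by field.
  exact: exp_double_ge.
(* At [25 / 36 / 256] the bound [1 + x <= exp x] is nearly sharp; eight squarings, with decimals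
   rounded down, lead back to [25 / 36]. *)
have h0 : 1.0027126 <= exp (25 / 36 / 256) by have := exp_ineq1_le (25 / 36 / 256); lra.
have h1 : 1.0054325 <= exp (25 / 36 / (256 / 2)) by apply: dbl h0 _ _; lra.
have h2 : 1.0108945 <= exp (25 / 36 / (256 / 2 / 2)) by apply: dbl h1 _ _; lra.
have h3 : 1.0219076 <= exp (25 / 36 / (256 / 2 / 2 / 2)) by apply: dbl h2 _ _; lra.
have h4 : 1.0442951 <= exp (25 / 36 / (256 / 2 / 2 / 2 / 2)) by apply: dbl h3 _ _; lra.
have h5 : 1.0905522 <= exp (25 / 36 / (256 / 2 / 2 / 2 / 2 / 2)) by apply: dbl h4 _ _; lra.
have h6 : 1.1893041 <= exp (25 / 36 / (256 / 2 / 2 / 2 / 2 / 2 / 2)) by apply: dbl h5 _ _; lra.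
have h7 : 1.4144442 <= exp (25 / 36 / (256 / 2 / 2 / 2 / 2 / 2 / 2 / 2)) by apply: dbl h6 _ _; lra.
have h8 : 2 <= exp (25 / 36 / (256 / 2 / 2 / 2 / 2 / 2 / 2 / 2 / 2)) by apply: dbl h7 _ _; lra.
by rewrite (_ : 25 / 36 = 25 / 36 / (256 / 2 / 2 / 2 / 2 / 2 / 2 / 2 / 2)) //; field.
Qed.

Lemma exp_mul_nat (n : nat) (x : R) : exp (INR n * x) = exp x ^ n.
Proof.
elim: n => [|n IH]; first by rewrite /= Rmult_0_l exp_0.
by rewrite S_INR Rmult_plus_distr_r Rmult_1_l exp_plus IH /= Rmult_comm.
Qed.

Lemma pow2_exp (n : nat) : 2 ^ n = exp (INR n * ln 2).
Proof. by rewrite exp_mul_nat exp_ln //; lra. Qed.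

(* With [D = 2^432 e^s]: [2^k <= e^(s/4)] and [ln D <= 300 + s <= 300 e^(s/300)],
   so the claim reduces to [2^67 * 300^18 < 2^216]. *)
Lemma sqrt_gt_log_pow (D : R) (k : nat) : 2 ^ 432 * 16 ^ k <= D ->
  4 * (2 ^ 65 * 2 ^ k) * ln D ^ 18 < sqrt D.
Proof.
move=> hD.
have p0 : 0 < 2 ^ 432 by apply: pow_lt; lra.
have k0 : 1 <= 16 ^ k by apply: pow_R1_Rle; lra.
have D0 : 0 < D by apply: Rlt_le_trans hD; apply: Rmult_lt_0_compat; lra.
pose s := ln D - 432 * ln 2.
have e16 : 16 ^ k = 2 ^ (4 * k) by rewrite pow_mult; congr (_ ^ _); lra.
have hs : 4 * INR k * ln 2 <= s.
  have : ln (2 ^ 432 * 16 ^ k) <= ln D by apply: ln_le_compat => //; apply: Rmult_lt_0_compat; lra.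
  have e4 : INR (4 * k) = 4 * INR k by rewrite -multE mult_INR [INR 4]INR_IZR_INZ.
  have e432 : INR 432 = 432 by rewrite INR_IZR_INZ.
  by rewrite e16 !pow2_exp -exp_plus ln_exp e4 e432 /s; lra.
have l2 : 0 < ln 2 by have := ln_lt_2; lra.
have s0 : 0 <= s by apply: Rle_trans hs; apply: Rmult_le_pos; [have := pos_INR k|]; lra.
have hk : 2 ^ k <= exp (s / 4).
  by rewrite pow2_exp; apply: exp_le_compat; lra.
have l0 : 0 <= ln D by rewrite /s in s0; lra.
have hl : ln D ^ 18 <= 300 ^ 18 * exp (s / 4).
  apply: (Rle_trans _ ((300 * exp (s / 300)) ^ 18)).
    apply: pow_incr; split=> //.
    have := exp_ineq1_le (s / 300); have := ln2_le; rewrite /s; lra.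
  rewrite Rpow_mult_distr -exp_mul_nat; apply: Rmult_le_compat_l; first by apply: pow_le; lra.
  have -> : INR 18 = 18 by rewrite INR_IZR_INZ.
  by apply: exp_le_compat; lra.
(* Of the two factors [exp (s / 4)], one absorbs [2 ^ k] and the other the power of the
   logarithm. *)
have hsq : sqrt D = 2 ^ 216 * (exp (s / 4) * exp (s / 4)).
  have -> : D = (2 ^ 216 * (exp (s / 4) * exp (s / 4))) * (2 ^ 216 * (exp (s / 4) * exp (s / 4))).
    rewrite pow2_exp -!exp_plus -{1}(exp_ln D) //; congr exp.
    have -> : INR 216 = 216 by rewrite INR_IZR_INZ.
    by rewrite /s; lra.
  apply: sqrt_square; apply: Rmult_le_pos; first by apply: pow_le; lra.
  by rewrite -exp_plus; apply/Rlt_le/exp_pos.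
have E0 := exp_pos (s / 4).
rewrite hsq; apply: (Rle_lt_trans _ (4 * (2 ^ 65 * exp (s / 4)) * (300 ^ 18 * exp (s / 4)))).
  apply: Rmult_le_compat => //.
  - by apply: Rmult_le_pos; [lra | apply: Rmult_le_pos; apply: pow_le; lra].
  - exact: pow_le.
  - by apply: Rmult_le_compat_l; [lra | apply: Rmult_le_compat_l => //; apply: pow_le; lra].
rewrite (_ : 4 * (2 ^ 65 * exp (s / 4)) * (300 ^ 18 * exp (s / 4)) =
  (4 * 2 ^ 65 * 300 ^ 18) * (exp (s / 4) * exp (s / 4))); last by ring.
apply: Rmult_lt_compat_r; first exact: Rmult_lt_0_compat.
rewrite !pow_IZR -!mult_IZR; apply: IZR_lt; vm_compute; reflexivity.
Qed.

Lemma dprim66_bound (d : nat) (L : R) : (0 < d)%nat -> L >= / (ln (INR d)) ^ 18 ->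
  L * sqrt (INR d) <= 4 * INR (2 ^ (genus_g d).-1) -> (d <= dprim 66)%nat.
Proof.
move=> d0 hL key; rewrite leqNgt; apply/negP => d66.
(* Truncated subtraction treats two cases at once: for [g < 66] it gives [k = 0], and [d > dprim 66]
   alone yields [hD]. *)
set g := genus_g d in key; pose k := (g - 66)%nat.
have hD : 2 ^ 432 * 16 ^ k <= INR d.
  rewrite pow_IZR; have [g66|g66] := leqP 66 g.
    apply: Rle_trans (dprim_ge g66) _; apply: le_INR; apply/leP; exact: dprim_genus_le.
  rewrite /k (eqP (ltnW g66 : (g - 66 == 0)%nat)) /= Rmult_1_r.
  by apply: Rle_trans dprim66_ge _; apply: le_INR; apply/leP/ltnW.
have hlog := sqrt_gt_log_pow hD.
have hh : INR (2 ^ g.-1) <= 2 ^ 65 * 2 ^ k.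
  rewrite pow_INR -pow_add; apply: Rle_pow => /=; first lra.
  by apply/leP; rewrite /k; lia.
have l0 : 0 < ln (INR d).
  rewrite -ln_1; apply: ln_increasing; first lra.
  apply: Rlt_le_trans hD; have h16 : 1 <= 16 ^ k by apply: pow_R1_Rle; lra.
  have : 1 < 2 ^ 432 by apply: Rlt_pow_R1; [lra | apply/leP].
  by move=> h2; nra.
have p0 := pow_lt _ 18 l0; have s0 := sqrt_pos (INR d).
have h1 : / ln (INR d) ^ 18 * sqrt (INR d) <= 4 * (2 ^ 65 * 2 ^ k).
  apply: (Rle_trans _ (L * sqrt (INR d))); last by lra.
  by apply: Rmult_le_compat_r; lra.
have h2 : sqrt (INR d) <= 4 * (2 ^ 65 * 2 ^ k) * ln (INR d) ^ 18.
  apply: (Rmult_le_reg_l (/ ln (INR d) ^ 18)); first exact: Rinv_0_lt_compat.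
  by apply: Rle_trans h1 _; apply: Req_le; field; lra.
lra.
Qed.
End RealBounds.

From mathcomp Require Import all_boot all_order all_algebra ring lra Rstruct.

(** * Reduction of binary quadratic forms *)

Section BinaryForms.
Import GRing.Theory Num.Theory Order.TTheory.
Local Open Scope ring_scope.

Definition qform (F : int * int * int) (x y : int) : int :=
  F.1.1 * x ^+ 2 + F.1.2 * x * y + F.2 * y ^+ 2.

Definition qdisc (F : int * int * int) : int := F.1.2 ^+ 2 - 4 * F.1.1 * F.2.

(** The polar form [F (u + v) - F u - F v] at [u = (x, y)] and [v = (z, w)]. *)
Definition qpolar (F : int * int * int) (x y z w : int) : int :=
  2 * F.1.1 * x * z + F.1.2 * (x * w + z * y) + 2 * F.2 * y * w.

(* [f] is [F] precomposed with the matrix of columns [(x, y)] and [(z, w)]. *)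
Definition qpullback (f F : int * int * int) (x y z w : int) : Prop :=
  x * w - z * y = 1 /\ f = (qform F x y, qpolar F x y z w, qform F z w).

Definition qreduced (F : int * int * int) : bool :=
  [&& 0 < F.1.1, `|F.1.2| <= F.1.1, F.1.1 <= F.2 &
      ((`|F.1.2| == F.1.1) || (F.1.1 == F.2)) ==> (0 <= F.1.2)].

(** Proper equivalence, directed so that the first coefficient of [f] is the value of [F] at the
    first column. *)
Definition reducible_to (f F : int * int * int) : Prop :=
  exists x y z w, qpullback f F x y z w.

Lemma qdisc_pullback f F x y z w : qpullback f F x y z w -> qdisc f = qdisc F.
Proof.
case=> h ->; rewrite /qdisc /qform /qpolar /=.
have -> : F.1.2 ^+ 2 - 4 * F.1.1 * F.2 =
  (F.1.2 ^+ 2 - 4 * F.1.1 * F.2) * (x * w - z * y) ^+ 2 by rewrite h; ring.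
by ring.
Qed.

Lemma reducible_to_shift a b c n F :
  reducible_to (a, b + 2 * a * n, a * n ^+ 2 + b * n + c) F ->
  reducible_to (a, b, c) F.
Proof.
move=> [x [y [z [w [h [ea eb ec]]]]]].
exists x, y, (z - n * x), (w - n * y); split; first by rewrite -h; ring.
have {}eb : b = qpolar F x y z w - 2 * a * n by rewrite -eb; ring.
have {}ec : c = qform F z w - a * n ^+ 2 - b * n by rewrite -ec; ring.
rewrite ec eb ea /qform /qpolar; congr (_, _, _); ring.
Qed.

Lemma reducible_to_swap a b c F :
  reducible_to (c, - b, a) F -> reducible_to (a, b, c) F.
Proof.
move=> [x [y [z [w [h [ec eb ea]]]]]].
exists (- z), (- w), x, y; split; first by rewrite -h; ring.
rewrite ec ea -[b]opprK eb /qform /qpolar; congr (_, _, _); ring.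
Qed.

Lemma reducible_to_refl f : reducible_to f f.
Proof.
exists 1, 0, 0, 1; split; first by ring.
by case: f => [[a b] c]; rewrite /qform /qpolar /=; congr (_, _, _); ring.
Qed.

Lemma exists_shift (a b : int) : 0 < a -> exists n, - a < b + 2 * a * n <= a.
Proof.
move=> a0; exists (- ((b + a - 1) %/ (2 * a))%Z).
have a2 : 0 < 2 * a by lia.
have h := divz_eq (b + a - 1) (2 * a).
have h1 := modz_ge0 (b + a - 1) (lt0r_neq0 a2).
have h2 := ltz_pmod (b + a - 1) a2.
have -> : b + 2 * a * - ((b + a - 1) %/ (2 * a))%Z =
  (b + a - 1) - ((b + a - 1) %/ (2 * a))%Z * (2 * a) - a + 1 by ring.
move: h h1 h2; set m := (_ %% _)%Z; set u := (_ %/ _)%Z * _ => h h1 h2.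
lia.
Qed.

(** Gauss reduction: translate the middle coefficient into [(- a, a]], then swap the outer
    coefficients while the last one is smaller, which decreases [a]. *)
Lemma exists_reduced (a b c : int) :
  0 < a -> qdisc (a, b, c) < 0 -> exists2 F, qreduced F & reducible_to (a, b, c) F.
Proof.
have [k] := ubnP `|a|%N; elim: k => // k IH in a b c *; move=> hk a0.
have [n] := exists_shift b a0.
set b' := b + _; set c' := a * n ^+ 2 + b * n + c => /andP[hb1 hb2] D0.
have {}D0 : qdisc (a, b', c') < 0.
  by move: D0; rewrite /qdisc /=; congr (_ < _); rewrite /b' /c'; ring.
suff [F rF hF] : exists2 F, qreduced F & reducible_to (a, b', c') F.
  by exists F => //; apply: reducible_to_shift hF.
have c0 : 0 < c' by move: D0; rewrite /qdisc /= => D0; nia.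
have [lt_c|le_c] := ltP c' a.
  have [||F rF hF] := IH c' (- b') a _ c0.
  - by move: hk lt_c c0 a0; clear; lia.
  - by move: D0; rewrite /qdisc /=; congr (_ < _); ring.
  by exists F => //; apply: reducible_to_swap.
(* With equal outer coefficients, one more swap turns a negative middle coefficient positive. *)
have [/andP[/eqP ac bn]|nswap] := boolP ((a == c') && (b' < 0)).
  exists (c', - b', a); last by apply/reducible_to_swap/reducible_to_refl.
  by rewrite /qreduced /=; move: hb1 hb2 ac bn a0; clear; lia.
exists (a, b', c'); last exact: reducible_to_refl.
by rewrite /qreduced /=; move: nswap le_c hb1 hb2 a0; clear; lia.
Qed.

(** Allows [y >= 0] in the first column, so that only half of each ellipse is counted; this halves
    the final constant to 4. *)
Lemma pullback_opp f F x y z w :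
  qpullback f F x y z w -> qpullback f F (- x) (- y) (- z) (- w).
Proof.
case=> h ->; split; first by rewrite -h; ring.
by rewrite /qform /qpolar; congr (_, _, _); ring.
Qed.

(* The first column of the matrix determines the second one up to adding a
   multiple of the first, hence the middle coefficient modulo [2 a]. *)
Lemma pullback_same_col f f' F x y z w z' w' :
  qpullback f F x y z w -> qpullback f' F x y z' w' ->
  f'.1.1 = f.1.1 /\ exists n, f'.1.2 = f.1.2 + 2 * f.1.1 * n.
Proof.
case=> h -> [h' ->] /=; split=> //.
(* If the second columns differ by [n (x, y)], the determinant of the difference with [(z, w)]
   isolates [n]. *)
set n := (z' - z) * w - (w' - w) * z; exists n.
have ez : z' = z + n * x.
  apply/eqP; rewrite -subr_eq0; apply/eqP; rewrite /n.
  have -> : z' - (z + ((z' - z) * w - (w' - w) * z) * x) =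
    z * ((x * w' - z' * y) - (x * w - z * y)) + (z' - z) * (1 - (x * w - z * y)) by ring.
  by rewrite h h'; ring.
have ew : w' = w + n * y.
  apply/eqP; rewrite -subr_eq0; apply/eqP; rewrite /n.
  have -> : w' - (w + ((z' - z) * w - (w' - w) * z) * y) =
    w * ((x * w' - z' * y) - (x * w - z * y)) + (w' - w) * (1 - (x * w - z * y)) by ring.
  by rewrite h h'; ring.
by rewrite ez ew /qpolar /qform; ring.
Qed.
End BinaryForms.

(** * Classes, ideal codes and lattice points in ellipses *)

Section Counting.
Import GRing.Theory Num.Theory Order.TTheory.
Local Open Scope ring_scope.

(** Counting by an injective relation spares a choice of the reduced form and matrix attached to
    each code. *)
Lemma rel_leq_size (S T : eqType) (R : S -> T -> Prop) (s : seq S) (t : seq T) :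
  uniq s -> (forall x, x \in s -> exists2 y, y \in t & R x y) ->
  (forall x x' y, x \in s -> x' \in s -> R x y -> R x' y -> x = x') ->
  (size s <= size t)%N.
Proof.
elim: s t => //= x s IH t /andP[xs us] tot inj.
have [y yt Rxy] := tot x (mem_head _ _).
have t0 : (0 < size t)%N by case: (t) yt.
rewrite -(prednK t0) ltnS -(size_rem yt); apply: IH => //.
  move=> z zs; have zxs : z \in x :: s by rewrite inE zs orbT.
  have [y' yt' Rzy'] := tot z zxs.
  exists y' => //; case: (eqVneq y' y) => [e|ne].
    rewrite e in Rzy'; move: xs.
    by rewrite (inj x z y) ?mem_head ?inE ?zs ?orbT.
  by have := perm_mem (perm_to_rem yt) y'; rewrite inE (negPf ne) /= => <-.
by move=> z z' w zs zs'; apply: inj; rewrite inE ?zs ?zs' orbT.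
Qed.

Lemma squarefree_sqr_dvd (m p : nat) :
  (0 < m)%N -> squarefree m -> prime p -> ~~ (p * p %| m)%N.
Proof.
move=> m0 /forallP sq pp; apply/negP => h.
have ple : (p < m.+1)%N.
  by rewrite ltnS; apply: leq_trans (dvdn_leq m0 h); rewrite leq_pmull ?prime_gt0.
by have := sq (Ordinal ple); rewrite /= pp h.
Qed.

(** A common prime [p] of the coefficients makes [p ^ 2] divide [d], against squarefreeness unless
    [p = 2]. This supplies the gcd clause of [reduced_form]. *)
Lemma fund_disc_primitive (d : nat) (a b c : int) :
  neg_fund_disc d -> qdisc (a, b, c) = - d%:Z -> gcdn (gcdn `|a| `|b|) `|c| = 1%N.
Proof.
move=> [d0 fd]; rewrite /qdisc /= => D.
set g := gcdn _ _; apply/eqP; apply: contraT => g1.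
have g0 : (0 < g)%N.
  rewrite /g !gcdn_gt0 !absz_gt0; apply: contraT; rewrite !negb_or !negbK.
  by move=> /andP[/andP[/eqP a0 /eqP b0] /eqP c0]; move: d0 D; rewrite a0 b0 c0; clear; lia.
have p_pr : prime (pdiv g) by apply: pdiv_prime; lia.
move: (pdiv g) p_pr (pdiv_dvd g) => p pp pg.
have /dvdzP[a' ea] : (p %| a)%Z by apply: dvdn_trans pg _; rewrite /g -gcdnA dvdn_gcdl.
have /dvdzP[b' eb] : (p %| b)%Z.
  by apply: dvdn_trans pg _; rewrite /g gcdnAC dvdn_gcdr.
have /dvdzP[c' ec] : (p %| c)%Z by apply: dvdn_trans pg _; rewrite /g dvdn_gcdr.
have ed : (d%:Z = (p * p)%N%:Z * (4 * a' * c' - b' ^+ 2)).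
  by rewrite -[LHS]opprK -D ea eb ec PoszM; ring.
have pd : (p * p %| d)%N.
  by rewrite -[d]absz_nat ed abszM absz_nat dvdn_mulr.
case: fd => [[_ sq]|[d4 [m14 sq]]].
  by move: (squarefree_sqr_dvd d0 sq pp); rewrite pd.
have ed4 : d = (4 * (d %/ 4))%N by move: d4; clear; lia.
have m0 : (0 < d %/ 4)%N by move: d0 ed4; clear; lia.
have := squarefree_sqr_dvd m0 sq pp.
(* For [p = 2], the number [d / 4 = 4 a' c' - b' ^ 2] is 0 or 3 modulo 4, but it has to be 1 or
   2. *)
have [p2|p2] := eqVneq p 2%N.
  move=> _; move: ed m14 ed4; rewrite p2 -mulrA; clear; set m := (d %/ 4)%N.
  move=> ed m14 ed4; have {ed} ed : m%:Z = 4 * (a' * c') - b' ^+ 2.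
    by move: ed ed4; set z := a' * c'; set w := b' ^+ 2; clear; lia.
  have [u bu] : exists u : int, b' ^+ 2 = 4 * u \/ b' ^+ 2 = 4 * u + 1.
    have [v [->|->]] : exists v, b' = 2 * v \/ b' = 2 * v + 1.
      by exists (b' %/ 2)%Z; clear; lia.
    + by exists (v ^+ 2); left; ring.
    + by exists (v ^+ 2 + v); right; ring.
  by move: ed bu m14; set z := a' * c'; set w := b' ^+ 2; clear; lia.
rewrite ed4 Gauss_dvdr in pd; first by rewrite pd.
rewrite coprimeMl; have c4 : coprime p 4.
  have c2 : coprime p 2 by rewrite prime_coprime // dvdn_prime2.
  by rewrite -[4%N]/(2 * 2)%N coprimeMr c2.
by rewrite c4.
Qed.

Definition classes (d : nat) : {set 'I_d.+1 * 'I_(2 * d).+1 * 'I_d.+1} :=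
  [set t : 'I_d.+1 * 'I_(2 * d).+1 * 'I_d.+1 | reduced_form d t.1.1 (Posz t.1.2 - Posz d) t.2].

Definition form_of (d : nat) (T : 'I_d.+1 * 'I_(2 * d).+1 * 'I_d.+1) : int * int * int :=
  (T.1.1%:Z, T.1.2%:Z - d%:Z, T.2%:Z).

(** Since [b ^ 2 <= a c], the discriminant gives [3 a c <= d]. *)
Lemma reduced_coef_bounds (d : nat) (a b c : int) :
  0 < a -> `|b| <= a -> a <= c -> b ^+ 2 - 4 * a * c = - d%:Z ->
  c <= d%:Z /\ a <= d%:Z.
Proof. by move=> a0 ba ac D; split; nia. Qed.

Lemma class_of_reduced (d : nat) (F : int * int * int) :
  neg_fund_disc d -> qdisc F = - d%:Z -> qreduced F ->
  exists2 T, T \in classes d & form_of T = F.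
Proof.
case: F => [[a b] c] fd D; rewrite /qreduced /= => /and4P[a0 ba ac sgn].
have [cd ad] := reduced_coef_bounds a0 ba ac D.
have g1 := fund_disc_primitive fd D.
have ha : (`|a| < d.+1)%N by move: ad a0; clear; lia.
have hb : (absz (b + d%:Z)%R < (2 * d).+1)%N by move: ad a0 ba; clear; lia.
have hc : (`|c| < d.+1)%N by move: cd a0 ac; clear; lia.
have eb : (absz (b + d%:Z))%:Z - d%:Z = b by move: ad a0 ba; clear; lia.
have ea : (`|a|%N)%:Z = a by move: a0; clear; lia.
have ec : (`|c|%N)%:Z = c by move: a0 ac; clear; lia.
exists (Ordinal ha, Ordinal hb, Ordinal hc); last first.
  by rewrite /form_of /= ea eb ec.
rewrite inE /reduced_form /= eb ea ec g1 eqxx andbT.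
have -> : b * b - 4 * a * c == - d%:Z by apply/eqP; rewrite -D /qdisc /=; ring.
by move: a0 ba ac sgn; clear; lia.
Qed.

Lemma form_of_reduced (d : nat) T : T \in classes d ->
  [/\ (0 < T.1.1)%N, (T.1.1 <= d)%N & qdisc (form_of T) = - d%:Z].
Proof.
rewrite inE => /and5P[/eqP D a0 _ _ _]; split=> //; by rewrite -ltnS.
Qed.

(** The norm of [t + w] for [w = (odd d + sqrt (- d)) / 2], when 4 divides [d + odd d]. *)
Definition qpoly (d t : nat) : nat := (t * t + odd d * t + (d + odd d) %/ 4)%N.

Lemma qpolyE (d t : nat) : (4 %| d + odd d)%N ->
  (4 * qpoly d t = (2 * t + odd d) * (2 * t + odd d) + d)%N.
Proof.
move=> h; have e : (4 * ((d + odd d) %/ 4) = d + odd d)%N by rewrite mulnC divnK.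
by rewrite /qpoly !mulnDr e; case: (odd d); rewrite /= ?mul1n ?mul0n; ring.
Qed.

(* [(k, t)] encodes the ideal [k (m, t + w)] of norm [n = k^2 m], where [w] is
   a root of the polynomial [qpoly]. *)
Definition ideal_code (d n : nat) (x : nat * nat) : bool :=
  [&& 0 < x.1, x.1 ^ 2 %| n, x.2 < n %/ x.1 ^ 2 & n %/ x.1 ^ 2 %| qpoly d x.2]%N.

(** The norm form of the ideal [(m, t + w)] divided by its norm [m]; the factor [k] is dropped. *)
Definition code_form (d n : nat) (x : nat * nat) : int * int * int :=
  ((n %/ x.1 ^ 2)%N%:Z, (2 * x.2 + odd d)%N%:Z,
   (qpoly d x.2 %/ (n %/ x.1 ^ 2))%N%:Z).

Lemma qdisc_code_form (d n : nat) x : (4 %| d + odd d)%N -> ideal_code d n x ->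
  qdisc (code_form d n x) = - d%:Z.
Proof.
move=> d4 /and4P[_ _ _ /divnK].
rewrite /code_form; set m := (n %/ _)%N; set c := (_ %/ m)%N => h.
have := qpolyE x.2 d4; rewrite -h /qdisc /= => e.
have {}e : (4 * (c * m))%N%:Z =
  ((2 * x.2 + odd d) * (2 * x.2 + odd d) + d)%N%:Z by rewrite e.
by move: e; rewrite !(PoszD, PoszM); set u := (2 * x.2%:Z + _)%R => e; lia.
Qed.

(** As [4 a F(x, y) = (2 a x + b y) ^ 2 + d y ^ 2], the condition [F(x, y) <= N] bounds [|y|] by
    [sqrt (4 a N / d)] and, for each [y], puts [x] in an interval of length [sqrt (4 a N) / a]. *)
Definition ymax (d a N : nat) : nat := Nat.sqrt (4 * a * N %/ d).
Definition umax (a N : nat) : nat := (Nat.sqrt (4 * a * N) %/ a)%N.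

(** For fixed [y] the quotient is [x] plus a constant; it numbers the integers of the interval from
    its left end. *)
Definition shiftx (a N : nat) (b x y : int) : nat :=
  absz ((2 * a%:Z * x + b * y + (Nat.sqrt (4 * a * N))%:Z) %/ (2 * a%:Z))%Z.

Lemma sqrt_sqr_le (z n : nat) : (z * z <= n)%N -> (z <= Nat.sqrt n)%N.
Proof.
move=> h; apply/ssrnat.leP; rewrite -(Nat.sqrt_square z); apply: Nat.sqrt_le_mono.
by lia.
Qed.

Lemma sqrt_le_sqr n : (Nat.sqrt n * Nat.sqrt n <= n)%N.
Proof. by apply/ssrnat.leP; case: (Nat.sqrt_spec n (Nat.le_0_l n)). Qed.

Lemma qform_box (d a N : nat) (b c x y : int) :
  (0 < d)%N -> (0 < a)%N -> qdisc (a%:Z, b, c) = - d%:Z -> 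
  qform (a%:Z, b, c) x y <= N%:Z ->
  [/\ (absz y <= ymax d a N)%N,
      0 <= 2 * a%:Z * x + b * y + (Nat.sqrt (4 * a * N))%:Z
    & (shiftx a N b x y <= umax a N)%N].
Proof.
rewrite /qdisc /qform /= => d0 a0 D FN.
have key : (2 * a%:Z * x + b * y) ^+ 2 + d%:Z * y ^+ 2 <= (4 * a * N)%N%:Z.
  have -> : (2 * a%:Z * x + b * y) ^+ 2 + d%:Z * y ^+ 2 =
     4 * a%:Z * (a%:Z * x ^+ 2 + b * x * y + c * y ^+ 2).
    by rewrite -[d%:Z]opprK -D; ring.
  by rewrite !PoszM -mulrA -[leRHS]mulrA ler_pM2l // ler_pM2l.
set z := 2 * a%:Z * x + b * y in key *.
have hz : (absz z <= Nat.sqrt (4 * a * N))%N.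
  apply: sqrt_sqr_le; rewrite -lez_nat; apply: le_trans key.
  have := sqr_ge0 y; have : 0 <= d%:Z by []; rewrite PoszM.
  by set w := y ^+ 2; move=> h1 h2; nia.
split.
- apply: sqrt_sqr_le; rewrite leq_divRL //; rewrite -lez_nat; apply: le_trans key.
  have := sqr_ge0 z; set w := z ^+ 2; rewrite !PoszM => h1; nia.
- by move: hz; set s := Nat.sqrt _; clear; lia.
rewrite /shiftx -/z /umax; set s := Nat.sqrt _ in hz *.
have zs : 0 <= z + s%:Z by move: hz; clear; lia.
rewrite -(gez0_abs zs) -PoszM divz_nat absz_nat.
rewrite leq_divRL //.
have := leq_trunc_div (absz (z + s%:Z)) (2 * a)%N; set q := (_ %/ _)%N.
by move: hz; clear; lia.
Qed.
End Counting.

(** * Counting ideals of norm at most [N] class by class *)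

Section IdealCount.
Import GRing.Theory Num.Theory Order.TTheory.
Local Open Scope ring_scope.

(** Both [k] and [k'] are the gcd of the coordinates of one vector; the second columns serve as
    Bezout coefficients. *)
Lemma primitive_col_inj (k k' x y z w x' y' z' w' : int) :
  0 < k -> 0 < k' -> x * w - z * y = 1 -> x' * w' - z' * y' = 1 ->
  k * x = k' * x' -> k * y = k' * y' -> [/\ k = k', x = x' & y = y'].
Proof.
move=> k0 k0' h h' ex ey.
have e1 : k = k' * (x' * w - z * y').
  have -> : k' * (x' * w - z * y') = (k' * x') * w - z * (k' * y') by ring.
  by rewrite -ex -ey -[LHS]mulr1 -h; ring.
have e2 : k' = k * (x * w' - z' * y).
  have -> : k * (x * w' - z' * y) = (k * x) * w' - z' * (k * y) by ring.
  by rewrite ex ey -[LHS]mulr1 -h'; ring.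
have ek : k = k'.
  move: e1 e2; set u := x' * w - z * y'; set v := x * w' - z' * y.
  have le_of (i j c : int) : 0 < i -> 0 < j -> i = j * c -> j <= i.
    by move=> i0 j0 e; have c0 : 0 < c by [rewrite -(pmulr_rgt0 _ j0) -e];
      rewrite e ler_peMr // ltW.
  by move=> e1 e2; apply/le_anti; rewrite (le_of k' k v) // (le_of k k' u).
rewrite -ek in ex ey; have kn0 : k != 0 by rewrite gt_eqF.
by split=> //; [exact: mulfI kn0 _ _ ex | exact: mulfI kn0 _ _ ey].
Qed.

Lemma shiftx_inj (a N : nat) (b x x' y : int) : (0 < a)%N ->
  0 <= 2 * a%:Z * x + b * y + (Nat.sqrt (4 * a * N))%:Z ->
  0 <= 2 * a%:Z * x' + b * y + (Nat.sqrt (4 * a * N))%:Z ->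
  shiftx a N b x y = shiftx a N b x' y -> x = x'.
Proof.
rewrite /shiftx => a0; set s := (Nat.sqrt _)%:Z => h h' e.
have a2 : 0 < 2 * a%:Z by lia.
have {}e : ((2 * a%:Z * x + b * y + s) %/ (2 * a%:Z))%Z =
  ((2 * a%:Z * x' + b * y + s) %/ (2 * a%:Z))%Z.
  by move: e => /(congr1 Posz); rewrite !gez0_abs // divz_ge0.
have a2n : 2 * a%:Z != 0 by rewrite gt_eqF.
by move: e; rewrite -!addrA ![2 * a%:Z * _]mulrC !divzMDl //; lia.
Qed.

(* The second component of [q] encodes the pair [(k y, shiftx)] in base
   [(umax a N).+1], so that [q] determines the vector [k (x, y)]. *)
Definition code_rel (d N : nat) (p : nat * (nat * nat))
    (q : 'I_d.+1 * 'I_(2 * d).+1 * 'I_d.+1 * nat) : Prop :=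
  exists x y z w : int,
  [/\ qpullback (code_form d p.1 p.2) (form_of q.1) x y z w, 0 <= y, q.1 \in classes d
    & let a := q.1.1.1 : nat in
      let k := p.2.1%:Z in
      q.2 = (absz (k * y)%R * (umax a N).+1 + shiftx a N (form_of q.1).1.2 (k * x)%R (k * y)%R)%N].

Lemma code_norm (d n : nat) x : ideal_code d n x ->
  (n = x.1 ^ 2 * (n %/ x.1 ^ 2))%N.
Proof. by case/and4P=> _ h _ _; rewrite mulnC divnK. Qed.

(** The vector [k (x, y)] lies in the ellipse because [F] takes there the value
    [k ^ 2 m = n <= N]. *)
Lemma code_rel_box (d N : nat) p (q : 'I_d.+1 * 'I_(2 * d).+1 * 'I_d.+1 * nat) (x y z w : int) :
  (0 < d)%N -> (0 < p.1 <= N)%N -> ideal_code d p.1 p.2 ->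
  qpullback (code_form d p.1 p.2) (form_of q.1) x y z w -> q.1 \in classes d ->
  let a := q.1.1.1 : nat in let k := p.2.1%:Z in let b := (@form_of d q.1).1.2 in
  [/\ (absz (k * y)%R <= ymax d a N)%N,
      0 <= 2 * a%:Z * (k * x) + b * (k * y) + (Nat.sqrt (4 * a * N))%:Z
    & (shiftx a N b (k * x)%R (k * y)%R <= umax a N)%N].
Proof.
move=> d0 /andP[n0 nN] cp pb cl a k b; have [a0 ad D] := form_of_reduced cl.
apply: (@qform_box _ _ _ _ (form_of q.1).2) => //.
have -> : qform (a%:Z, b, (form_of q.1).2) (k * x) (k * y) =
  k ^+ 2 * qform (form_of q.1) x y by rewrite /a /b /qform /form_of /=; ring.
have := code_norm cp; case: pb => _ [<- _ _]; rewrite /k expr2 -!PoszM lez_nat mulnn => <-.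
by [].
Qed.

(** The base expansion returns [k y], then [k x]; primitivity separates [k] from [(x, y)], and the
    first column fixes [m] and [t] modulo [m]. *)
Lemma code_rel_inj (d N : nat) p p' q :
  (0 < d)%N -> (0 < p.1 <= N)%N -> (0 < p'.1 <= N)%N ->
  ideal_code d p.1 p.2 -> ideal_code d p'.1 p'.2 ->
  code_rel N p q -> @code_rel d N p' q -> p = p'.
Proof.
move=> d0 pN pN' cp cp' [x [y [z [w [pb y0 cl e]]]]] [x' [y' [z' [w' [pb' y0' _ e']]]]].
have [_ s0 hu] := code_rel_box d0 pN cp pb cl.
have [_ s0' hu'] := code_rel_box d0 pN' cp' pb' cl.
have [a0 _ _] := form_of_reduced cl.
move: e e' s0 s0' hu hu' => /=; set k := p.2.1%:Z; set k' := p'.2.1%:Z.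
set u := shiftx _ _ _ _ _; set u' := shiftx _ _ _ (k' * x') _ => e e' s0 s0' hu hu'.
have /eqP := etrans (esym e) e'.
have := @edivn_eq (umax q.1.1.1 N).+1 (absz (k * y)%R) u; rewrite ltnS => /(_ hu) E.
have := @edivn_eq (umax q.1.1.1 N).+1 (absz (k' * y')%R) u'; rewrite ltnS => /(_ hu') E'.
move/eqP => eqe; rewrite eqe E' in E; case: E => ey eu.
have k0 : 0 < k by case/and4P: cp.
have k0' : 0 < k' by case/and4P: cp'.
have {}ey : k * y = k' * y'.
  have h : 0 <= k * y by rewrite mulr_ge0 // ltW.
  have h' : 0 <= k' * y' by rewrite mulr_ge0 // ltW.
  by rewrite -(gez0_abs h) -(gez0_abs h') ey.
have ex : k * x = k' * x'.
  by apply: (shiftx_inj a0 s0); last (by rewrite -/u -eu /u' -ey); rewrite ey.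
have [det _] := pb; have [det' _] := pb'.
have [ek exx eyy] := primitive_col_inj k0 k0' det det' ex ey.
rewrite -exx -eyy in pb'; have [em [n en]] := pullback_same_col pb pb'.
have {}ek : p.2.1 = p'.2.1 by case: ek.
move: em en; rewrite /code_form /= -ek => -[em] en.
have e1 : p.1 = p'.1 by rewrite (code_norm cp) (code_norm cp') -ek em.
have e2 : p.2.2 = p'.2.2.
  case/and4P: cp => _ _ h _; case/and4P: cp' => _ _ h' _; rewrite -ek em in h'.
  move: h h' en; set m := (_ %/ _)%N => h h' en.
  have {}en : p'.2.2%:Z = p.2.2%:Z + m%:Z * n by move: en; case: (odd d); clear; lia.
  have [n1|n1|n1] := ltgtP n 0; last by move: en; rewrite n1; clear; lia.
  - have : m%:Z * n <= m%:Z * (- 1) by rewrite ler_wpM2l //; move: n1; clear; lia.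
    by move: h h' en; clear; lia.
  - have : m%:Z * 1 <= m%:Z * n by rewrite ler_wpM2l //; move: n1; clear; lia.
    by move: h h' en; clear; lia.
by case: (p) (p') e1 ek e2 => [? [? ?]] [? [? ?]] /= -> -> ->.
Qed.

Lemma code_rel_ex (d N : nat) p :
  neg_fund_disc d -> (4 %| d + odd d)%N -> (0 < p.1 <= N)%N -> ideal_code d p.1 p.2 ->
  exists2 q, (q.1 \in classes d) &&
     (q.2 < (ymax d q.1.1.1 N).+1 * (umax q.1.1.1 N).+1)%N & @code_rel d N p q.
Proof.
move=> fd d4 pN cp; have d0 : (0 < d)%N by case: fd.
have D := qdisc_code_form d4 cp.
have m0 : 0 < (code_form d p.1 p.2).1.1 by case/and4P: cp => _ _ h _; rewrite /code_form /=; lia.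
move: D m0 ; case E : (code_form d p.1 p.2) => [[a b] c] D a0.
have D0 : qdisc (a, b, c) < 0 by rewrite D; lia.
have [F rF] := exists_reduced a0 D0.
rewrite -E => -[x [y [z [w pb]]]].
have DF : qdisc F = - d%:Z by rewrite -(qdisc_pullback pb) E.
have [T clT eT] := class_of_reduced fd DF rF.
have [x' [y' [z' [w' [pb' y0]]]]] :
  exists x y z w, qpullback (code_form d p.1 p.2) F x y z w /\ 0 <= y.
  have [y0|y0] := leP 0 y; first by exists x, y, z, w.
  by exists (- x), (- y), (- z), (- w); split; [exact: pullback_opp | lia].
rewrite -eT in pb'.
pose cde := (absz (p.2.1%:Z * y')%R * (umax T.1.1 N).+1 +
  shiftx T.1.1 N (form_of T).1.2 (p.2.1%:Z * x')%R (p.2.1%:Z * y')%R)%N.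
have [h1 _ h3] := @code_rel_box d N p (T, cde) x' y' z' w' d0 pN cp pb' clT.
exists (T, cde); last by exists x', y', z', w'; split.
rewrite /= clT /cde /=; move: h1 h3 => /=.
set A := absz _; set U := umax _ _; set u := shiftx _ _ _ _ _; set Y := ymax _ _ _.
move=> h1 h3; apply: (@leq_trans (A * U.+1 + U.+1)%N); first by rewrite ltn_add2l ltnS.
by rewrite -mulSnr leq_mul2r ltnS h1 orbT.
Qed.

(** The coefficient [a] cancels in the product, since [d * ymax ^ 2 <= 4 a N] and
    [a * umax ^ 2 <= 4 N]; the bound is thus uniform over the classes. *)
Lemma box_size_le (d a N : nat) : (0 < d)%N -> (0 < a <= d)%N ->
  ((ymax d a N).+1 * (umax a N).+1 <=
     Nat.sqrt (16 * N ^ 2 %/ d) + 2 * Nat.sqrt (4 * N) + 1)%N.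
Proof.
move=> d0 /andP[a0 ad].
have hy := sqrt_le_sqr (4 * a * N %/ d); rewrite -/(ymax d a N) in hy.
have hu : (a * (umax a N * umax a N) <= 4 * N)%N.
  have h1 := sqrt_le_sqr (4 * a * N).
  have h2 := leq_trunc_div (Nat.sqrt (4 * a * N)) a; rewrite -/(umax a N) in h2.
  rewrite -(leq_pmul2l a0); apply: leq_trans (_ : _ <= 4 * a * N)%N _; last by lia.
  apply: leq_trans h1; apply: leq_trans (leq_mul h2 h2); lia.
have {}hy : (d * (ymax d a N * ymax d a N) <= 4 * a * N)%N.
  rewrite mulnC; apply: leq_trans (leq_trunc_div (4 * a * N) d).
  by rewrite leq_mul2r hy orbT.
have h1 : (ymax d a N * umax a N <= Nat.sqrt (16 * N ^ 2 %/ d))%N.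
  apply: sqrt_sqr_le; rewrite leq_divRL // -(leq_pmul2l a0).
  by have := leq_mul hy hu; clear; lia.
have h2 : (ymax d a N <= Nat.sqrt (4 * N))%N.
  apply: sqrt_sqr_le; rewrite -(leq_pmul2l d0); apply: leq_trans hy _.
  by rewrite -mulnA [(a * N)%N]mulnC mulnA mulnC leq_mul2r ad orbT.
have h3 : (umax a N <= Nat.sqrt (4 * N))%N.
  by apply: sqrt_sqr_le; apply: leq_trans hu; rewrite leq_pmull.
rewrite mulSnr mulnSr; move: h1 h2 h3; clear; lia.
Qed.

Theorem card_ideals_upto (d N : nat) (s : seq (nat * (nat * nat))) :
  neg_fund_disc d -> (4 %| d + odd d)%N -> uniq s ->
  (forall p, p \in s -> (0 < p.1 <= N)%N && ideal_code d p.1 p.2) ->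
  (size s <= class_number d *
     (Nat.sqrt (16 * N ^ 2 %/ d) + 2 * Nat.sqrt (4 * N) + 1))%N.
Proof.
move=> fd d4 us hs; have d0 : (0 < d)%N by case: fd.
set B := (_ + _ + 1)%N.
have -> : (class_number d * B = size [seq (T, i) | T <- enum (classes d), i <- iota 0 B])%N.
  by rewrite size_allpairs size_iota -cardE.
apply: (@rel_leq_size _ _ (code_rel N)) => //.
  move=> p /hs /andP[pN cp]; have [q /andP[clq hq] R] := code_rel_ex fd d4 pN cp.
  exists q => //; case: q clq hq R => [T i] /= clT hi R.
  apply/allpairsP; exists (T, i); split=> //=; first by rewrite mem_enum.
  rewrite mem_iota /=; apply: leq_trans hi _; rewrite add0n.
  by have [a0 ad _] := form_of_reduced clT; apply: box_size_le; rewrite ?a0.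
move=> p p' q /hs /andP[pN cp] /hs /andP[pN' cp']; exact: code_rel_inj.
Qed.
End IdealCount.

(** * Ideals of prescribed norm from roots of [qpoly] *)

Section IdealCodes.
Local Open Scope nat_scope.

Lemma qpoly_eqmod (d m t u : nat) : t = u %[mod m] -> qpoly d t = qpoly d u %[mod m].
Proof.
move=> h; rewrite /qpoly -modnDml -(modnDm (t * t)) -(modnMm t t) -(modnMmr (odd d)) h.
by rewrite modnMm modnMmr modnDm modnDml.
Qed.

Lemma dvdn_eqmod (m a b : nat) : a = b %[mod m] -> (m %| a) = (m %| b).
Proof. by rewrite /dvdn => ->. Qed.

Lemma dvdn_qpoly_mod (d m t : nat) : (m %| qpoly d (t %% m)) = (m %| qpoly d t).
Proof. by apply/dvdn_eqmod/qpoly_eqmod; rewrite modn_mod. Qed.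

(** Conjugation sends the root [x] to [- x - odd d]. *)
Lemma dvdn_qpoly_conj (d m x y : nat) :
  m %| x + y + odd d -> m %| qpoly d x -> m %| qpoly d y.
Proof.
move=> hS hx; have e : qpoly d x + y * (x + y + odd d) = qpoly d y + x * (x + y + odd d).
  by rewrite /qpoly; ring.
by rewrite -(@dvdn_addl (x * (x + y + odd d))) ?dvdn_mull // -e dvdn_add ?dvdn_mull.
Qed.

Lemma qpoly_shift (d t u : nat) :
  qpoly d (t + u) = qpoly d t + u * (2 * t + odd d) + u * u.
Proof. by rewrite /qpoly; ring. Qed.

Lemma hensel_qpoly (d p t j : nat) : prime p -> p %| qpoly d t ->
  ~~ (p %| 2 * t + odd d) -> exists2 u, p ^ j.+1 %| qpoly d u & u = t %[mod p].
Proof.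
move=> pp pt nt; elim: j => [|j [u /dvdnP[c hc] eu]]; first by exists t; rewrite ?expn1.
have nu : coprime p (2 * u + odd d).
  rewrite prime_coprime //; apply: contra nt; congr is_true; apply: dvdn_eqmod.
  by rewrite -modnDml -modnMmr eu modnMmr modnDml.
have p0 := prime_gt0 pp.
(* Newton step: [- a] inverts the derivative [2 u + odd d] modulo [p], and [c] is
   [qpoly d u / p ^ j.+1]. *)
have [a _] := Bezoutl (2 * u + odd d) p0.
rewrite (eqP nu : gcdn _ _ = 1) => /dvdnP[f hf].
exists (u + p ^ j.+1 * (a * c)); last by rewrite expnS -!mulnA addnC [p * _]mulnC modnMDl.
rewrite qpoly_shift hc.
have -> : c * p ^ j.+1 + p ^ j.+1 * (a * c) * (2 * u + odd d) +
    p ^ j.+1 * (a * c) * (p ^ j.+1 * (a * c)) =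
  p ^ j.+1 * (c * (1 + a * (2 * u + odd d))) + p ^ j.+1 * (p ^ j.+1 * (a * c * (a * c))).
  by ring.
rewrite hf expnSr dvdn_add //; first by rewrite dvdn_mul // mulnA dvdn_mull.
by rewrite dvdn_mul // expnS -mulnA dvdn_mulr.
Qed.

Lemma exists_root_odd (d p x : nat) : (4 %| d + odd d) -> prime p -> p != 2 ->
  p %| x * x + d -> exists2 t, p %| qpoly d t & 2 * t + odd d = x %[mod p].
Proof.
move=> d4 pp p2 hx; have po : odd p by case: (even_prime pp) p2 => // ->.
have p0 := prime_gt0 pp.
have hh : 2 * p.+1./2 = p.+1 by move: po; clear; lia.
(* This is [(x - odd d) / 2] modulo [p], with [p.-1] for [-1] and [(p.+1)./2] for the inverse of
   2. *)
exists ((x + odd d * p.-1) * (p.+1)./2).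
  rewrite -(@Gauss_dvdr _ 4) ?qpolyE //; last first.
    by rewrite -[4]/(2 * 2) coprimeMr prime_coprime // dvdn_prime2 // (negPf p2).
  have e : 2 * ((x + odd d * p.-1) * (p.+1)./2) + odd d = x + p * (x + odd d * p.-1 + odd d).
    have -> : 2 * ((x + odd d * p.-1) * (p.+1)./2) = (x + odd d * p.-1) * p.+1 by rewrite mulnCA hh.
    by case: p p0 {pp p2 hx po hh} => //= p _; lia.
  rewrite e; set k := x + _ + _; rewrite (_ : _ + d = x * x + d + p * (k * (2 * x + p * k))); last by ring.
  by rewrite dvdn_add // dvdn_mulr.
have -> : 2 * ((x + odd d * p.-1) * (p.+1)./2) = (x + odd d * p.-1) * p.+1 by rewrite mulnCA hh.
have -> : (x + odd d * p.-1) * p.+1 + odd d = x + (x + odd d * p.-1 + odd d) * p.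
  by case: p p0 {pp p2 hx po hh} => //= p _; lia.
by rewrite addnC modnMDl.
Qed.

Definition codes (d n : nat) (s : seq (nat * nat)) : bool := uniq s && all (ideal_code d n) s.

(** Multiplication of ideals by the integer [p]. *)
Lemma codes_mul_sqr (d n p : nat) s : 0 < p -> 0 < n -> codes d n s ->
  codes d (p ^ 2 * n) [seq (p * x.1, x.2) | x <- s].
Proof.
move=> p0 n0 /andP[us /allP cs]; apply/andP; split.
  rewrite map_inj_in_uniq // => -[k t] [k' t'] _ _ /= [ek ->].
  by move/eqP: ek; rewrite eqn_pmul2l // => /eqP ->.
apply/allP => _ /mapP[[k t] /cs /and4P[/= k0 kn tm mq] ->].
by rewrite /ideal_code /= muln_gt0 p0 k0 expnMn dvdn_pmul2l ?expn_gt0 ?p0 // divnMl ?expn_gt0 ?p0 // kn tm mq.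
Qed.

(** A Hensel root and its conjugate; they differ modulo [p] because the derivative does not vanish
    there. *)
Lemma codes_two (d p t j : nat) : prime p -> p %| qpoly d t ->
  ~~ (p %| 2 * t + odd d) ->
  exists u v, [/\ u != v, ideal_code d (p ^ j.+1) (1, u) & ideal_code d (p ^ j.+1) (1, v)].
Proof.
move=> pp pt nt; have [u hu eu] := hensel_qpoly j pp pt nt.
have m0 : 0 < p ^ j.+1 by rewrite expn_gt0 prime_gt0.
pose v := (u + odd d) * (p ^ j.+1).-1.
have hv : u + v + odd d = (u + odd d) * p ^ j.+1.
  by rewrite /v; case: (p ^ j.+1) m0 => //= m _; lia.
exists (u %% p ^ j.+1), (v %% p ^ j.+1); split.
- apply: contra nt => /eqP e.
  have {}e : u = v %[mod p].
    have pm : p %| p ^ j.+1 by rewrite expnS dvdn_mulr.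
    by rewrite -(modn_dvdm u pm) e modn_dvdm.
  have : p %| u + v + odd d by rewrite hv expnS mulnCA dvdn_mulr.
  congr is_true; apply: dvdn_eqmod.
  have e2 : u + v = u + u %[mod p] by rewrite -modnDmr -e modnDmr.
  rewrite -modnDml e2 modnDml addnn -mul2n.
  by rewrite -modnDml -modnMmr eu modnMmr modnDml.
- by rewrite /ideal_code /= exp1n dvd1n divn1 ltn_mod m0 dvdn_qpoly_mod.
- rewrite /ideal_code /= exp1n dvd1n divn1 ltn_mod m0 dvdn_qpoly_mod.
  by apply: (@dvdn_qpoly_conj _ _ u) => //; rewrite hv dvdn_mull.
Qed.

Lemma codes_one (d : nat) : codes d 1 [:: (1, 0)].
Proof. by rewrite /codes /= /ideal_code /= exp1n divn1 dvd1n. Qed.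

(** Two primitive ideals, together with [p] times those of norm [p ^ (j - 2)]; hence induction by
    steps of two. *)
Lemma codes_split (d p t j : nat) : prime p -> p %| qpoly d t ->
  ~~ (p %| 2 * t + odd d) -> exists2 s, codes d (p ^ j) s & size s = j.+1.
Proof.
move=> pp pt nt; have p0 := prime_gt0 pp.
have [k] := ubnP j; elim: k j => // k IH [|[|j]] hj.
- by exists [:: (1, 0)]; rewrite // expn0 codes_one.
- have [u [v [uv cu cv]]] := codes_two 0 pp pt nt.
  by exists [:: (1, u); (1, v)]; rewrite //= /codes /= cu cv inE xpair_eqE uv.
have [s cs ss] := IH j (ltnW (hj : j.+1 < k)).
have [u [v [uv cu cv]]] := codes_two j.+1 pp pt nt.
exists [:: (1, u), (1, v) & [seq (p * x.1, x.2) | x <- s]]; last by rewrite /= size_map ss.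
have := codes_mul_sqr p0 _ cs; rewrite expn_gt0 p0 -expnD add2n => /(_ isT) /andP[us as_].
rewrite /codes /= cu cv us as_ !inE !xpair_eqE (negPf uv) /= !andbT.
have nin w : (1, w) \notin [seq (p * x.1, x.2) | x <- s].
  apply/mapP => -[x _ [e _]]; have : p %| 1 by rewrite e dvdn_mulr.
  by rewrite dvdn1 => /eqP p1; rewrite p1 in pp.
by rewrite !nin.
Qed.

Lemma codes_ramified (d p t j : nat) : prime p -> p %| qpoly d t ->
  exists2 s, codes d (p ^ j) s & size s = 1.
Proof.
move=> pp pt; have p0 := prime_gt0 pp.
have [k] := ubnP j; elim: k j => // k IH [|[|j]] hj.
- by exists [:: (1, 0)]; rewrite // expn0 codes_one.
- exists [:: (1, t %% p)]; rewrite // /codes /= /ideal_code /=.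
  by rewrite exp1n dvd1n divn1 expn1 ltn_mod p0 dvdn_qpoly_mod pt.
have [s cs ss] := IH j (ltnW (hj : j.+1 < k)).
exists [seq (p * x.1, x.2) | x <- s]; last by rewrite size_map.
by have := codes_mul_sqr p0 _ cs; rewrite expn_gt0 p0 -expnD add2n => /(_ isT).
Qed.

Lemma codes_inert (d p j : nat) : 0 < p ->
  exists2 s, codes d (p ^ j) s & size s = ~~ odd j.
Proof.
move=> p0; have [k] := ubnP j; elim: k j => // k IH [|[|j]] hj.
- by exists [:: (1, 0)]; rewrite // expn0 codes_one.
- by exists [::].
have [s cs ss] := IH j (ltnW (hj : j.+1 < k)).
exists [seq (p * x.1, x.2) | x <- s]; last by rewrite size_map ss /= !negbK.
by have := codes_mul_sqr p0 _ cs; rewrite expn_gt0 p0 -expnD add2n => /(_ isT).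
Qed.

(** The product of two ideals of coprime norms, with the root glued by the Chinese remainder
    theorem. *)
Definition merge_codes (m n : nat) (x y : nat * nat) : nat * nat :=
  let M := m %/ x.1 ^ 2 in let N := n %/ y.1 ^ 2 in
  (x.1 * y.1, chinese M N x.2 y.2 %% (M * N)).

Lemma divn_mulmul (a b m n : nat) : 0 < a -> 0 < b -> a %| m -> b %| n ->
  m * n %/ (a * b) = (m %/ a) * (n %/ b).
Proof.
move=> a0 b0 /dvdnP[u ->] /dvdnP[v ->].
by rewrite mulnACA !mulnK // muln_gt0 a0.
Qed.

(** Recovers the first factor from the product, for the injectivity of merging. *)
Lemma merge_codes_fst (d m n : nat) x y : coprime m n ->
  ideal_code d m x -> ideal_code d n y -> gcdn m (x.1 * y.1) = x.1.
Proof.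
move=> mn /and4P[_ hx _ _] /and4P[_ hy _ _].
have hx1 : x.1 %| m by apply: dvdn_trans hx; rewrite dvdn_exp.
have hy1 : y.1 %| n by apply: dvdn_trans hy; rewrite dvdn_exp.
by rewrite Gauss_gcdl ?(coprime_dvdr hy1) //; apply/gcdn_idPr.
Qed.

Lemma merge_codes_snd (d m n : nat) x y : coprime m n ->
  ideal_code d m x -> ideal_code d n y ->
  (merge_codes m n x y).2 %% (m %/ x.1 ^ 2) = x.2 /\
  (merge_codes m n x y).2 %% (n %/ y.1 ^ 2) = y.2.
Proof.
move=> mn cx cy.
have co : coprime (m %/ x.1 ^ 2) (n %/ y.1 ^ 2).
  case/and4P: cx => _ hx _ _; case/and4P: cy => _ hy _ _.
  by apply: coprime_dvdl (dvdn_div hx) _; apply: coprime_dvdr (dvdn_div hy) _.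
case/and4P: cx => _ _ tx _; case/and4P: cy => _ _ ty _; rewrite /merge_codes /=.
split; first by rewrite modn_dvdm ?dvdn_mulr // chinese_modl // modn_small.
by rewrite modn_dvdm ?dvdn_mull // chinese_modr // modn_small.
Qed.

Lemma codes_coprime (d m n : nat) s s' : coprime m n ->
  codes d m s -> codes d n s' ->
  codes d (m * n) [seq merge_codes m n x y | x <- s, y <- s'].
Proof.
move=> mn /andP[us /allP cs] /andP[us' /allP cs'].
have nm : coprime n m by rewrite coprime_sym.
apply/andP; split.
  apply: allpairs_uniq => // -[x y] [x' y'].
  move=> /allpairsP[[a b] /= [/cs c1 /cs' c2 [? ?]]]; subst a b.
  move=> /allpairsP[[a b] /= [/cs c1' /cs' c2' [? ?]]] e; subst a b.
  have [e1 e2] := merge_codes_snd mn c1 c2; have [e1' e2'] := merge_codes_snd mn c1' c2'.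
  have ek : x.1 * y.1 = x'.1 * y'.1 by case: e.
  have ex : x.1 = x'.1.
    by rewrite -(merge_codes_fst mn c1 c2) ek (merge_codes_fst mn c1' c2').
  have ey : y.1 = y'.1.
    by rewrite -(merge_codes_fst nm c2 c1) mulnC ek mulnC (merge_codes_fst nm c2' c1').
  rewrite e ex ey e1' e2' in e1 e2.
  by case: (x) (x') (y) (y') ex ey e1 e2 => [? ?] [? ?] [? ?] [? ?] /= -> -> -> ->.
apply/allP => _ /allpairsP[[x y] /= [/cs cx /cs' cy ->]].
have co : coprime (m %/ x.1 ^ 2) (n %/ y.1 ^ 2).
  case/and4P: cx => _ hx _ _; case/and4P: cy => _ hy _ _.
  by apply: coprime_dvdl (dvdn_div hx) _; apply: coprime_dvdr (dvdn_div hy) _.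
have [e1 e2] := merge_codes_snd mn cx cy.
case/and4P: cx => x0 hx tx qx; case/and4P: cy => y0 hy ty qy.
rewrite /ideal_code [(merge_codes _ _ _ _).1]/= muln_gt0 x0 y0 expnMn dvdn_mul //=.
rewrite divn_mulmul ?expn_gt0 ?x0 ?y0 // ltn_mod muln_gt0.
rewrite (leq_ltn_trans _ tx) // (leq_ltn_trans _ ty) // Gauss_dvd //=.
by rewrite -(dvdn_qpoly_mod d (m %/ _)) e1 qx -(dvdn_qpoly_mod d (n %/ _)) e2 qy.
Qed.
End IdealCodes.

(** * The Kronecker character and its divisor sums *)

Section Character.
Import GRing.Theory Num.Theory Order.TTheory.
Local Open Scope ring_scope.

(** Split, ramified and inert primes; a split prime has a simple root, [2 t + odd d] being the
    derivative of [qpoly]. *)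
Lemma kron_primeP (d p : nat) (x := kron_prime d p) :
  (4 %| d + odd d)%N -> prime p ->
  [\/ x = 1 /\ (exists2 t, p %| qpoly d t & ~~ (p %| 2 * t + odd d))%N,
      x = 0 /\ (exists t, p %| qpoly d t)%N | x = -1].
Proof.
rewrite /x /kron_prime => d4 pp; have [p2|p2] := eqVneq p 2%N.
  have [od|ed] := boolP (odd d).
    have [/eqP d7|_] := boolP (d %% 8 == 7)%N; last by apply: Or33.
    apply: Or31; split; first by rewrite RealsE.
    by exists 0%N; rewrite p2 /qpoly ?od //=; move: d7; clear; lia.
  apply: Or32; split; first by rewrite RealsE.
  (* Here [qpoly] takes the even value [t ^ 2 + t] at [t = d / 4]. *)
  exists (d %/ 4)%N; rewrite p2 /qpoly (negPf ed) /= mul0n !addn0.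
  by rewrite dvdn2 oddD oddM andbb addbb.
have [pd|npd] := boolP (p %| d)%N.
  apply: Or32; split; first by rewrite RealsE.
  by have [|t ht _] := @exists_root_odd d p 0 d4 pp p2 _; [rewrite mul0n | exists t].
case: ifP => [/existsP[x' hx]|_]; last by apply: Or33.
apply: Or31; split; first by rewrite RealsE.
have [t ht et] := exists_root_odd d4 pp p2 hx; exists t => //.
rewrite (dvdn_eqmod et); apply: contra npd => px.
by rewrite -(dvdn_addr _ (dvdn_mulr x' px)).
Qed.

(** For character value 1, 0 or -1 the powers sum to [j + 1], to 1, or to the indicator of even [j]:
    the sizes of the three lists. *)
Lemma kron_prime_codes (d p j : nat) : (4 %| d + odd d)%N -> prime p ->
  exists2 s, codes d (p ^ j) s & \sum_(i < j.+1) kron_prime d p ^+ i = (size s)%:R.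
Proof.
move=> d4 pp; case: (kron_primeP d4 pp) => [[-> [t pt nt]]|[-> [t pt]]|->].
- have [s cs ss] := codes_split j pp pt nt; exists s; rewrite // ss.
  by under eq_bigr do rewrite expr1n; rewrite sumr_const card_ord.
- have [s cs ss] := codes_ramified j pp pt; exists s; rewrite // ss.
  by rewrite big_ord_recl big1 ?addr0 // => i _; rewrite expr0n.
- have [s cs ss] := codes_inert d j (prime_gt0 pp); exists s; rewrite // ss.
  elim: j {s cs ss} => [|j IH]; first by rewrite big_ord1.
  by rewrite big_ord_recr /= IH -signr_odd /=; case: (odd j); rewrite /= ?expr1 ?expr0; ring.
Qed.

Lemma kronE (d n : nat) : (0 < n)%N ->
  kron d n = \prod_(p <- primes n) kron_prime d p ^+ logn p n.
Proof.
rewrite /kron lt0n => /negPf ->; elim: (primes n) => [|p s IH] /=.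
  by rewrite big_nil RealsE.
by rewrite big_cons IH !RealsE.
Qed.

Lemma kron_pfactor (d p i m : nat) : prime p -> ~~ (p %| m)%N -> (0 < m)%N ->
  kron d (p ^ i * m) = kron_prime d p ^+ i * kron d m.
Proof.
move=> pp pm m0; case: i => [|i]; first by rewrite expn0 mul1n expr0 mul1r.
have p0 := prime_gt0 pp.
rewrite !kronE ?muln_gt0 ?expn_gt0 ?p0 //.
have pe : perm_eq (primes (p ^ i.+1 * m)) (p :: primes m).
  apply: uniq_perm; rewrite ?primes_uniq //= ?primes_uniq ?andbT.
    by rewrite mem_primes (negPf pm) !andbF.
  move=> q; rewrite inE !mem_primes muln_gt0 expn_gt0 p0 m0 /=.
  have [->|qp] := eqVneq q p; first by rewrite pp expnS -mulnA dvdn_mulr.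
  by have [pq|//] := boolP (prime q); rewrite /= Euclid_dvdM // Euclid_dvdX // dvdn_prime2 // (negPf qp).
rewrite (perm_big _ pe) big_cons lognM ?expn_gt0 ?p0 // pfactorK //.
rewrite (@logn_coprime p m) ?prime_coprime // addn0; congr (_ * _).
apply: eq_big_seq => q; rewrite mem_primes => /and3P[pq _ qm].
rewrite lognM ?expn_gt0 ?p0 // lognX logn_prime // (_ : (q == p) = false) ?muln0 //.
by apply: contraNF pm => /eqP <-.
Qed.

Lemma perm_divisors_pfactor (p j m : nat) : prime p -> ~~ (p %| m)%N -> (0 < m)%N ->
  perm_eq (divisors (p ^ j * m)) [seq (p ^ i * x)%N | i <- iota 0 j.+1, x <- divisors m].
Proof.
move=> pp pm m0; have p0 := prime_gt0 pp.
have lg x : x \in divisors m -> logn p x = 0%N.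
  rewrite -dvdn_divisors // => xm; rewrite logn_coprime // prime_coprime //.
  by apply: contra pm => /dvdn_trans ->.
apply: uniq_perm; first exact: divisors_uniq.
  apply: allpairs_uniq; [exact: iota_uniq | exact: divisors_uniq |].
  move=> [i x] [i' x'] h h' /= e.
  case/allpairsP: h => [[a b] /= [_ hx [? ?]]]; subst a b.
  case/allpairsP: h' => [[a b] /= [_ hx' [? ?]]]; subst a b.
  have [x0 x0'] : (0 < x /\ 0 < x')%N.
    by rewrite -!dvdn_divisors // in hx hx'; rewrite !(dvdn_gt0 m0).
  have ei : i = i'.
    have := congr1 (logn p) e; rewrite !lognM ?expn_gt0 ?p0 // !pfactorK //.
    by rewrite (lg _ hx) (lg _ hx') !addn0.
  by move/eqP: e; rewrite -ei eqn_pmul2l ?expn_gt0 ?p0 // => /eqP ->.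
move=> y; rewrite -dvdn_divisors ?muln_gt0 ?expn_gt0 ?p0 //.
apply/idP/idP => [hy|/allpairsP[[i x] [hi hx ->]]]; last first.
  by rewrite mem_iota /= add0n ltnS in hi; rewrite -dvdn_divisors // in hx; rewrite dvdn_mul // dvdn_exp2l.
have y0 : (0 < y)%N by apply: dvdn_gt0 hy; rewrite muln_gt0 expn_gt0 p0.
have [z pz ey] := pfactor_coprime pp y0.
apply/allpairsP; exists (logn p y, z); split; last by rewrite mulnC.
- rewrite mem_iota /= add0n ltnS.
  have := dvdn_leq_log p _ hy; rewrite muln_gt0 expn_gt0 p0 m0 => /(_ isT).
  by rewrite lognM ?expn_gt0 ?p0 // pfactorK // (@logn_coprime p m) ?prime_coprime // addn0.
- rewrite -dvdn_divisors //.
  have : (z %| p ^ j * m)%N by apply: dvdn_trans hy; rewrite ey dvdn_mulr.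
  by rewrite Gauss_dvdr // coprime_sym coprimeXl.
Qed.

(** Induction on [n]: split off the full power of its least prime and merge the two lists. *)
Lemma divisor_sum_codes (d n : nat) : (4 %| d + odd d)%N -> (0 < n)%N ->
  exists2 s, codes d n s & \sum_(m <- divisors n) kron d m = (size s)%:R.
Proof.
move=> d4; have [k] := ubnP n; elim: k n => // k IH n hn n0.
have [n1|n1] := leqP n 1.
  have -> : n = 1%N by lia.
  exists [:: (1, 0)%N]; first exact: codes_one.
  by rewrite big_seq1 kronE // big_nil.
have pp := pdiv_prime n1; set p := pdiv n in pp.
have [m pm en] := pfactor_coprime pp n0.
set j := logn p n in en; have j0 : (0 < j)%N by rewrite logn_gt0 mem_primes pp n0 pdiv_dvd.
have m0 : (0 < m)%N by move: n0; rewrite en muln_gt0 => /andP[].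
have npm : ~~ (p %| m)%N by rewrite -prime_coprime.
have mn : (m < n)%N by rewrite en ltn_Pmulr // -(expn0 p) ltn_exp2l ?prime_gt1.
have [s cs ss] := IH m (leq_trans mn hn) m0.
have [s' cs' ss'] := kron_prime_codes j d4 pp.
exists [seq merge_codes (p ^ j) m x y | x <- s', y <- s].
  by rewrite en mulnC; apply: codes_coprime => //; rewrite coprimeXl.
rewrite en mulnC (perm_big _ (perm_divisors_pfactor _ pp npm m0)) big_allpairs_dep.
rewrite size_allpairs natrM -ss -ss' -(big_mkord xpredT (fun i => kron_prime d p ^+ i)) mulr_suml.
rewrite -[iota 0 j.+1]/(index_iota 0 j.+1); apply: eq_bigr => i _.
rewrite mulr_sumr; apply: eq_big_seq => x; rewrite -dvdn_divisors // => xm.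
rewrite kron_pfactor ?(dvdn_gt0 m0) //.
by apply: contra npm => /dvdn_trans ->.
Qed.
End Character.

(** * Summing the divisor sums twice *)

Section DivisorSums.
Import GRing.Theory Num.Theory Order.TTheory.
Local Open Scope ring_scope.

(** Tagging each code with its norm keeps the lists for different [n] disjoint. *)
Lemma divisor_sum_upto (d M : nat) : neg_fund_disc d -> (4 %| d + odd d)%N ->
  \sum_(1 <= n < M.+1) \sum_(m <- divisors n) kron d m <=
  (class_number d * (Nat.sqrt (16 * M ^ 2 %/ d) + 2 * Nat.sqrt (4 * M) + 1))%:R.
Proof.
move=> fd d4.
have [S [uS hS ->]] : exists S : seq (nat * (nat * nat)), [/\ uniq S,
    forall p, p \in S -> (0 < p.1 <= M)%N && ideal_code d p.1 p.2
  & \sum_(1 <= n < M.+1) \sum_(m <- divisors n) kron d m = (size S)%:R].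
  elim: M => [|M [S [uS hS eS]]]; first by exists [::]; rewrite big_geq.
  have [s /andP[us /allP cs] es] := @divisor_sum_codes d M.+1 d4 isT.
  exists (S ++ [seq (M.+1, x) | x <- s]); split.
  - rewrite cat_uniq uS map_inj_uniq ?us ?andbT /= => [|x y [] //].
    apply/hasPn => _ /mapP[x _ ->]; apply/negP => /hS /=.
    by rewrite ltnn.
  - move=> p; rewrite mem_cat => /orP[/hS /andP[/andP[-> h] ->]|/mapP[x /cs h ->]].
      by rewrite (leq_trans h).
    by rewrite /= leqnn h.
  - by rewrite big_nat_recr //= eS es size_cat size_map natrD.
by rewrite ler_nat; apply: card_ideals_upto.
Qed.

(** The terms with [M < m < N] vanish; including them gives all [M] a common range of summation. *)
Lemma divisor_sum_floor (f : nat -> R) (N M : nat) : (M < N)%N ->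
  \sum_(1 <= n < M.+1) \sum_(m <- divisors n) f m =
  \sum_(1 <= m < N) f m * (M %/ m)%:R.
Proof.
elim: M => [|M IH] MN.
  rewrite big_geq // big_nat big1 // => m /andP[m0 _]; by rewrite div0n mulr0.
rewrite big_nat_recr //= IH; last exact: ltnW.
have -> : \sum_(m <- divisors M.+1) f m = \sum_(1 <= m < N) f m * (m %| M.+1)%:R.
  rewrite [RHS](bigID (fun m => m %| M.+1)%N) /= [X in _ + X]big1 ?addr0; last first.
    by move=> m /negPf ->; rewrite mulr0.
  rewrite [RHS](eq_bigr f) => [|m ->]; last by rewrite mulr1.
  rewrite -[RHS]big_filter; apply: perm_big; apply: uniq_perm.
  - exact: divisors_uniq.
  - by rewrite filter_uniq ?iota_uniq.
  move=> m; rewrite -dvdn_divisors // mem_filter mem_index_iota.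
  have [mM|//] := boolP (m %| M.+1)%N; rewrite (dvdn_gt0 _ mM) //=.
  by rewrite (leq_ltn_trans _ MN) // dvdn_leq.
rewrite -big_split /= !big_nat; apply: eq_bigr => m /andP[m0 _].
by rewrite -mulrDr -natrD divnS // addnC.
Qed.

(** The weight of [f m] after the second summation, of size about [N ^ 2 / (2 m)]. *)
Definition floor_sum (N m : nat) : nat := (\sum_(0 <= M < N) M %/ m)%N.

Lemma double_divisor_sum (f : nat -> R) (N : nat) :
  \sum_(0 <= M < N) \sum_(1 <= n < M.+1) \sum_(m <- divisors n) f m =
  \sum_(1 <= m < N) f m * (floor_sum N m)%:R.
Proof.
under eq_big_nat => M /andP[_ MN] do rewrite (divisor_sum_floor f MN).
rewrite exchange_big /=; apply: eq_bigr => m _.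
by rewrite -mulr_sumr /floor_sum natr_sum.
Qed.

Lemma floor_sum_rem (N m : nat) :
  (2 * (m * floor_sum N m) + 2 * (\sum_(0 <= M < N) M %% m) = N * N.-1)%N.
Proof.
elim: N => [|N IH]; first by rewrite /floor_sum !big_geq // !muln0.
rewrite /floor_sum !big_nat_recr //= -/(floor_sum N m).
by have := divn_eq N m; move: IH; clear; case: N => [|N] /=; nia.
Qed.

Lemma floor_sum_le (N m : nat) : (2 * (m * floor_sum N m) <= N * N.-1)%N.
Proof. by rewrite -(floor_sum_rem N m) leq_addr. Qed.

Lemma floor_sum_ge (N m : nat) : (0 < m)%N ->
  (N * N.-1 <= 2 * (m * floor_sum N m) + 2 * (N * m))%N.
Proof.
move=> m0; rewrite -(floor_sum_rem N m) leq_add2l leq_mul2l /=.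
rewrite -{2}(subn0 N) -sum_nat_const_nat; apply: leq_sum => M _.
by rewrite ltnW // ltn_mod.
Qed.

(** Each full block of [m] values with quotient [j] contributes [m * j], and the last partial block
    contributes [r * J]. *)
Lemma floor_sumE (m J r : nat) : (r <= m)%N ->
  (2 * floor_sum (m * J + r) m + m * J = J * (2 * r + m * J))%N.
Proof.
have step j s : (s < m)%N -> floor_sum (m * j + s).+1 m = (floor_sum (m * j + s) m + j)%N.
  move=> sm; rewrite /floor_sum big_nat_recr //= [(m * j)%N]mulnC divnMDl; last by lia.
  by rewrite divn_small // addn0.
have row j s : (s <= m)%N -> floor_sum (m * j + s) m = (floor_sum (m * j) m + s * j)%N.
  elim: s => [|s IH] sm; first by rewrite !addn0.
  by rewrite addnS step // IH ?(ltnW sm) // mulSnr addnA.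
move=> rm; rewrite row //; suff: (2 * floor_sum (m * J) m + m * J = J * (m * J))%N by lia.
elim: J => [|J IH]; first by rewrite /floor_sum muln0 big_geq.
by rewrite mulnS [(m + _)%N]addnC row //; lia.
Qed.

(** A one-sided bound, showing that [m * floor_sum N m] is almost decreasing in [m]; it controls the
    variation of the Abel kernel. *)
Lemma floor_sum_step (N m : nat) : (0 < m)%N ->
  (2 * (m.+1 * floor_sum N m.+1) <= 2 * (m * floor_sum N m) + (N %/ m.+1) * (N %/ m.+1).+1)%N.
Proof.
move=> m0; set J := (N %/ m)%N; set J' := (N %/ m.+1)%N.
have r' := ltn_pmod N (isT : 0 < m.+1)%N.
have E := @floor_sumE m J (N %% m) (ltnW (ltn_pmod N m0)).
have E' := @floor_sumE m.+1 J' (N %% m.+1) (ltnW r').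
have D := divn_eq N m; have D' := divn_eq N m.+1.
rewrite -/J mulnC in D; rewrite -/J' mulnC in D'.
rewrite -D in E; rewrite -D' in E'.
have JJ : (J' <= J)%N by apply: leq_div2l.
move: (floor_sum N m) (floor_sum N m.+1) (N %% m)%N (N %% m.+1)%N E E' D D' r' JJ.
clearbody J J'; move=> W W' r r'' E E' D D' hr /subnKC; set i := (J - J')%N => eJ.
rewrite -{}eJ in E D; clearbody i.
(* The expression [2 m j N - m ^ 2 (j ^ 2 + j)] equals [2 m W] at its maximum [j = N / m]; it is
   compared with its value at [j = J']. *)
have c1 : (2 * (m * J' * N) <= 2 * (m * W) + m * m * (J' * J' + J'))%N.
  have ii : (m * m * i <= m * m * (i * i))%N by rewrite leq_mul2l; case: (i) => [|?]; lia.
  have {}E : (m * (2 * W + m * (J' + i)) = m * ((J' + i) * (2 * r + m * (J' + i))))%N by rewrite E.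
  rewrite {}D; lia.
have c2 : (J' * N <= J' * (m.+1 * J'.+1))%N by rewrite leq_mul2l; lia.
have {}E' : (m.+1 * (2 * W' + m.+1 * J') = m.+1 * (J' * (2 * r'' + m.+1 * J')))%N by rewrite E'.
have c3 : (m.+1 * J' * N = m.+1 * J' * (m.+1 * J' + r''))%N by rewrite -D'.
by move: c1 c2 c3 E'; clear; lia.
Qed.
End DivisorSums.

(** * Abel summation against a kernel of bounded variation *)

Section AbelSummation.
Import GRing.Theory Num.Theory Order.TTheory.
Local Open Scope ring_scope.

Lemma abel_sum (b g : nat -> R) (n : nat) :
  \sum_(0 <= k < n) b k * g k =
  \sum_(0 <= k < n) (\sum_(0 <= i < k.+1) b i) * (g k - g k.+1) +
  (\sum_(0 <= i < n) b i) * g n.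
Proof.
elim: n => [|n IH]; first by rewrite !big_geq // mul0r addr0.
by rewrite !(@big_nat_recr _ _ _ n) //= IH; ring.
Qed.

Definition kernel (N k : nat) : R := (2 * (k.+1 * floor_sum N k.+1))%:R.

(** Linear in [N] for fixed [k]: this makes the finitely many initial terms negligible against
    [N ^ 2]. *)
Lemma kernel_near (N k : nat) : `|kernel N k - kernel N k.+1| <= N%:R * (2 * k.+2)%:R.
Proof.
have h1 := floor_sum_le N k.+1; have h2 := floor_sum_le N k.+2.
have h3 := @floor_sum_ge N k.+1 isT; have h4 := @floor_sum_ge N k.+2 isT.
rewrite ler_distl lerBlDr -natrM /kernel -!natrD !ler_nat.
by move: h1 h2 h3 h4; clear; lia.
Qed.

(** The possible increase is at most [2 (N / (k + 2)) ^ 2], bounded here by a telescoping term. *)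
Lemma kernel_step (N k : nat) :
  kernel N k.+1 <= kernel N k + 2 * (N%:R ^+ 2 * (k.+1%:R^-1 - k.+2%:R^-1)).
Proof.
apply: (@le_trans _ _ (kernel N k + (2 * (N %/ k.+2) ^ 2)%:R)).
  rewrite /kernel -natrD ler_nat; have := floor_sum_step N (isT : 0 < k.+1)%N.
  by set J := (N %/ _)%N => h; apply: (leq_trans h); rewrite leq_add2l; nia.
rewrite lerD2l natrM ler_pM2l // natrX.
have -> : k.+1%:R^-1 - k.+2%:R^-1 = (k.+1 * k.+2)%:R^-1 :> R.
  have h1 : k.+1%:R != 0 :> R by rewrite pnatr_eq0.
  have h2 : k.+1%:R + 1 != 0 :> R by rewrite natr1 pnatr_eq0.
  rewrite natrM -[k.+2%:R]natr1; move: h1 h2; move: (k.+1%:R : R) => x h1 h2.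
  by field; rewrite h1 h2.
rewrite ler_pdivlMr // -!natrX -natrM ler_nat.
have h := leq_trunc_div N k.+2; move: h; set J := (N %/ _)%N => h.
by apply: leq_trans (_ : (J * k.+2) ^ 2 <= _)%N; [rewrite expnMn leq_mul2l; nia | rewrite leq_sqr].
Qed.

Lemma norm_le_of_step (x y E : R) : 0 <= E -> y <= x + 2 * E -> `|x - y| <= x - y + 4 * E.
Proof. by move=> E0 h; rewrite ler_norml; apply/andP; split; lra. Qed.

(** The signed differences telescope to at most [N ^ 2], and the corrections for increases to at
    most [4 N ^ 2]. *)
Lemma kernel_variation (N n : nat) :
  \sum_(0 <= k < n) `|kernel N k - kernel N k.+1| <= 5 * N%:R ^+ 2.
Proof.
apply: (@le_trans _ _ (\sum_(0 <= k < n) ((kernel N k - kernel N k.+1) +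
   4 * (N%:R ^+ 2 * (k.+1%:R^-1 - k.+2%:R^-1))))).
  apply: ler_sum => k _; apply: norm_le_of_step (kernel_step N k).
  by rewrite mulr_ge0 ?exprn_ge0 // subr_ge0 lef_pV2 ?posrE // ler_nat.
rewrite big_split /= -!mulr_sumr.
rewrite (@telescope_sumr_eq _ 0 n (fun k => - kernel N k)); [|by []|by move=> k _; ring].
rewrite (@telescope_sumr_eq _ 0 n (fun k => - k.+1%:R^-1)); [|by []|by move=> k _; ring].
have h0 : kernel N 0 <= N%:R ^+ 2.
  rewrite /kernel -natrX ler_nat; apply: leq_trans (floor_sum_le N 1) _.
  by rewrite -mulnn leq_mul2l leq_pred orbT.
have hn : 0 <= kernel N n by exact: ler0n.
have hN : 0 <= N%:R ^+ 2 :> R by rewrite exprn_ge0 ?ler0n.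
rewrite invr1 (_ : - n.+1%:R^-1 - -1 = 1 - n.+1%:R^-1 :> R); last by rewrite opprK addrC.
rewrite mulrBr mulr1.
have h : 0 <= N%:R ^+ 2 * n.+1%:R^-1 :> R by rewrite mulr_ge0 ?invr_ge0 ?ler0n.
suff aux (a b A B : R) : a <= A -> 0 <= b -> 0 <= A -> 0 <= B ->
  - b - - a + 4 * (A - B) <= 5 * A by exact: aux.
by move=> *; lra.
Qed.

Lemma kernel_last (N : nat) : (0 < N)%N -> kernel N N.-1 = 0.
Proof.
move=> N0; rewrite /kernel prednK // /floor_sum big_nat big1 ?muln0 // => M /andP[_ MN].
by rewrite divn_small.
Qed.

(* Only the convergence of the series is used: [b k = chi (k.+1) / k.+1] enters
   through Abel summation against a kernel of total variation [O(N^2)], which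
   is what the second summation over [M < N] provides. *)
Lemma abel_limit (b : nat -> R) (L e : R) :
  Un_cv (sum_f_R0 b) L -> 0 < e ->
  exists2 C : R, 0 <= C & forall N, (0 < N)%N ->
  `|\sum_(0 <= k < N.-1) b k * kernel N k - L * kernel N 0| <= C * N%:R + 5 * e * N%:R ^+ 2.
Proof.
move=> cv e0; have [M0 hM] := cv e (elimT RltP e0).
pose S k := \sum_(0 <= i < k.+1) b i.
have {}hM k : (M0 <= k)%N -> `|S k - L| <= e.
  move=> Mk; have /RltP := hM k (elimT ssrnat.leP Mk).
  by rewrite !RealsE => /ltW.
(* Indices below [M0] are paid for by [kernel_near], the others by [e] times the variation. *)
pose c k : R := if (k < M0)%N then `|S k - L| * (2 * k.+2)%:R else 0.
have c0 k : 0 <= c k by rewrite /c; case: ifP => // _; rewrite mulr_ge0.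
exists (\sum_(0 <= k < M0) c k); first by rewrite sumr_ge0.
move=> N N0; rewrite abel_sum kernel_last // mulr0 addr0.
have -> : L * kernel N 0 = \sum_(0 <= k < N.-1) L * (kernel N k - kernel N k.+1).
  rewrite -mulr_sumr (@telescope_sumr_eq _ 0 N.-1 (fun k => - kernel N k)) //.
    by rewrite kernel_last //; congr (_ * _); ring.
  by move=> k _; ring.
rewrite -sumrB; apply: le_trans (ler_norm_sum _ _ _) _.
apply: (@le_trans _ _ (\sum_(0 <= k < N.-1) (c k * N%:R + e * `|kernel N k - kernel N k.+1|))).
  apply: ler_sum => k _; rewrite -mulrBl normrM -/(S k) /c; case: ltnP => [kM|Mk].
    apply: ler_wpDr; first by rewrite mulr_ge0 // ltW.
    by rewrite -mulrA [_ * N%:R]mulrC ler_wpM2l // kernel_near.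
  by rewrite mul0r add0r ler_wpM2r // hM.
rewrite big_split /= -mulr_suml -mulr_sumr; apply: lerD.
  rewrite ler_wpM2r //; have [nM|Mn] := leqP N.-1 M0.
    by rewrite [leRHS](@big_cat_nat _ _ _ N.-1) //= lerDl sumr_ge0.
  rewrite (@big_cat_nat _ _ _ M0) ?(ltnW Mn) //= [X in _ + X]big_nat [X in _ + X]big1 ?addr0 //.
  by move=> k /andP[h _]; rewrite /c ltnNge h.
rewrite [5 * e]mulrC -mulrA; apply: ler_wpM2l; [exact: ltW | exact: kernel_variation].
Qed.
End AbelSummation.

(** * The inequality between [L(1, chi)] and the class number *)

Section ClassNumber.
Import GRing.Theory Num.Theory Order.TTheory.
Local Open Scope ring_scope.

Lemma fund_disc_mod4 (d : nat) : neg_fund_disc d -> (4 %| d + odd d)%N.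
Proof. by case=> _ [[h _]|[h _]]; move: h; clear; lia. Qed.

Lemma kernel0 (N : nat) : kernel N 0 = N%:R * N.-1%:R.
Proof.
rewrite /kernel -natrM -(floor_sum_rem N 1); congr (_%:R).
by rewrite [X in (_ + 2 * X)%N]big1 ?muln0 ?addn0 // => M _; rewrite modn1.
Qed.

Lemma sum_kernel (d N : nat) :
  \sum_(0 <= k < N.-1) Rdiv (kron d k.+1) (INR k.+1) * kernel N k =
  2 * \sum_(0 <= M < N) \sum_(1 <= n < M.+1) \sum_(m <- divisors n) kron d m.
Proof.
rewrite double_divisor_sum big_add1 mulr_sumr; apply: eq_bigr => k _.
have h : k.+1%:R != 0 :> R by rewrite pnatr_eq0.
rewrite /kernel !natrM; rewrite RdivE INRE; move: (k.+1%:R : R) h => x h.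
by field.
Qed.

Lemma natsqrt_le_mul (q n : nat) (s : R) :
  0 <= s -> s ^+ 2 = n%:R -> (0 < n)%N -> (Nat.sqrt (16 * q ^ 2 %/ n))%:R * s <= 4 * q%:R.
Proof.
move=> s0 s2 n0; rewrite -(@ler_pXn2r _ 2) ?nnegrE ?mulr_ge0 ?ler0n //.
rewrite !exprMn s2 -!natrX -!natrM ler_nat.
have h := sqrt_le_sqr (16 * q ^ 2 %/ n); have h' := leq_trunc_div (16 * q ^ 2) n.
by rewrite -mulnn (leq_trans _ h') // leq_mul2r h orbT.
Qed.

(** Taking [N = P ^ 2] turns the square-root error term into a polynomial in [P]. *)
Lemma divisor_sum_double_le (d P : nat) (s : R) : neg_fund_disc d ->
  0 < s -> s ^+ 2 = d%:R ->
  2 * \sum_(0 <= M < P ^ 2) \sum_(1 <= n < M.+1) \sum_(m <- divisors n) kron d m <=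
  (class_number d)%:R * (4 * ((P ^ 2)%:R * (P ^ 2).-1%:R) / s + 2 * (P ^ 2)%:R * (4 * P%:R + 1)).
Proof.
move=> fd s0 s2; have d0 : (0 < d)%N by case: fd.
set N := (P ^ 2)%N; set h := class_number d.
have bd M : (M < N)%N -> \sum_(1 <= n < M.+1) \sum_(m <- divisors n) kron d m <=
  h%:R * (4 * M%:R / s + (4 * P%:R + 1)).
  move=> MN; apply: le_trans (divisor_sum_upto M fd (fund_disc_mod4 fd)) _.
  rewrite -/h natrM ler_wpM2l // 2!natrD -addrA lerD //.
    by rewrite ler_pdivlMr //; apply: natsqrt_le_mul => //; rewrite ltW.
  have hq : (Nat.sqrt (4 * M) <= 2 * P)%N.
    rewrite -leq_sqr -mulnn; apply: leq_trans (sqrt_le_sqr (4 * M)) _.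
    by rewrite expnMn leq_mul2l ltnW.
  by rewrite lerD2r -natrM ler_nat; move: hq; clear; lia.
apply: (@le_trans _ _ (2 * \sum_(0 <= M < N) h%:R * (4 * M%:R / s + (4 * P%:R + 1)))).
  by rewrite ler_pM2l // !big_nat; apply: ler_sum => M /andP[_ /bd].
rewrite -mulr_sumr big_split /= sumr_const_nat subn0 -mulr_suml -mulr_sumr -natr_sum.
have e : (2 * \sum_(0 <= M < N) M)%:R = N%:R * N.-1%:R :> R.
  have := floor_sum_rem N 1; rewrite mul1n [X in (_ + 2 * X)%N]big1 ?muln0 ?addn0; last first.
    by move=> M _; rewrite modn1.
  by rewrite -natrM => <-; congr (2 * _)%:R; apply: eq_bigr => M _; rewrite divn1.
rewrite -e natrM -[(4 * P%:R + 1) *+ N]mulr_natl le_eqVlt; apply/orP; left; apply/eqP.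
have aux (a b c u v : R) : 2 * (a * (4 * b * v + c * (4 * u + 1))) =
  a * (4 * (2 * b) * v + 2 * c * (4 * u + 1)) by ring.
exact: aux.
Qed.

(** The coefficients of [N ^ 2] in the analytic and geometric estimates are compared; a positive
    excess [A] would bound all [P]. *)
Theorem L1_le_class_number (d : nat) (L : R) :
  neg_fund_disc d -> Un_cv (L1_partial d) L ->
  L * Num.sqrt d%:R <= 4 * (class_number d)%:R.
Proof.
move=> fd cv; have d0 : (0 < d)%N by case: fd.
set s := Num.sqrt _; have s0 : 0 < s by rewrite sqrtr_gt0 ltr0n.
have s2 : s ^+ 2 = d%:R by rewrite sqr_sqrtr // ler0n.
set h : R := (class_number d)%:R; rewrite -ler_pdivlMr // leNgt; apply/negP => lt_L.
pose A := L - 4 * h / s; have A0 : 0 < A by rewrite subr_gt0.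
(* With [e = A / 20] the Abel error [5 e N ^ 2] is a quarter of [A N ^ 2], which leaves the factor
   [3 / 4]. *)
have e0 : 0 < A / 20 by rewrite divr_gt0.
have [C C0 hC] := abel_limit cv e0.
have h0 : 0 <= h by exact: ler0n.
(* For [P >= 1], [B P] dominates the lower-order terms [C + A + 2 h (4 P + 1)]. *)
pose B := C + A + 10 * h; have B0 : 0 <= B by rewrite /B; lra.
have key P : (0 < P)%N -> 3 * A * P%:R <= 4 * B.
  move=> P0; have P1 : 1 <= P%:R :> R by rewrite ler1n.
  have N0 : (0 < P ^ 2)%N by rewrite expn_gt0 P0.
  have := hC _ N0; rewrite sum_kernel kernel0 ler_distl => /andP[+ _].
  have := @divisor_sum_double_le d P s fd s0 s2; rewrite -/h.
  move: (2 * \sum_(0 <= M < _) _) => X.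
  have -> : (P ^ 2).-1%:R = P%:R ^+ 2 - 1 :> R.
    by apply/eqP; rewrite eq_sym subr_eq natr1 prednK // natrX.
  rewrite natrX; move: (P%:R : R) P1 => p p1 h1 h2.
  have {h1 h2} : p ^+ 2 * (A * (p ^+ 2 - 1)) <=
      p ^+ 2 * (C + 5 * (A / 20) * p ^+ 2 + 2 * h * (4 * p + 1)).
    have h3 := le_trans h2 h1; rewrite /A; move: h3; move: (s^-1) (A / 20) => v e.
    by set Y := _ * (_ - 1); rewrite /Y => h3; lra.
  have p0 : 0 < p by lra.
  rewrite ler_pM2l ?exprn_gt0 // => h3.
  have h4 : p * (3 * A * p) <= p * (4 * B).
    by rewrite /B; move: h3; rewrite expr2; have := mulr_ge0 (ltW A0) (ltW p0);
       have := mulr_ge0 h0 (ltW p0); nra.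
  by move: h4; rewrite ler_pM2l.
pose x := 4 * B / (3 * A).
have x0 : 0 <= x by rewrite divr_ge0 // mulr_ge0 // ltW.
have := archi_boundP x0; set P := Num.bound x => hP.
have P0 : (0 < P)%N by rewrite -(ltr0n R) (le_lt_trans x0).
have := key P P0; rewrite leNgt => /negP; apply.
by rewrite -ltr_pdivrMl ?mulr_gt0 // mulrC.
Qed.
End ClassNumber.

From Stdlib Require Import Reals.

Theorem theorem3p2 (d : nat) (L1 : R) :
  neg_fund_disc d ->
  Un_cv (L1_partial d) L1 ->
  (L1 >= / (ln (INR d)) ^ 18)%R ->
  class_number d = 2 ^ (genus_g d).-1 ->
  d <= dprim 66.
Proof.
move=> fd cv hL hh; apply: (dprim66_bound _ hL); first by case: fd.
rewrite -hh; apply/RleP; rewrite !RealsE; exact: L1_le_class_number.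
Qed.
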